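(* Under the Strong Exponential Time Hypothesis (SETH), Eccentricities does not have a sub-$mn$ time algorithm, in unweighted or weighted graphs, directed or undirected.
   Context: SETH: for every $\delta<1$ there is a $k$ such that $k$-SAT on $n$ variables cannot be solved in $O(2^{\delta n})$ time. Eccentricities: given a graph $G=(V,E)$, compute $\max_{y\in V} d_G(x,y)$ for every $x\in V$. A function $g(m,n)$ ($n$ vertices, $m$ edges) is sub-$mn$ if $g(m,n)=O(m^{\alpha}n^{\beta})$ for constants $\alpha,\beta$ with $\alpha+\beta<2$. *)

(* Defs.v *)
From Stdlib Require Import Reals Arith List Bool.
Import ListNotations.

(* Word RAM with w-bit words and unit-cost instructions. Registers and arrays
   are named by nat; a program mentions only finitely many of them, so the
   arrays amount to one interleaved memory. Control flow is structured, which
   agrees with jumps up to a constant factor in time. *)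

Inductive binop : Set :=
  | Add | Sub | Mul | Div | Mod | And | Or | Xor | Shl | Shr | Ltb | Eqb.

Inductive cmd : Set :=
  | Skip
  | Const (x c : nat)                 (* x := c *)
  | Op (o : binop) (x y z : nat)      (* x := y o z *)
  | Read (x a y : nat)                (* x := a[y] *)
  | Write (a x y : nat)               (* a[x] := y *)
  | Seq (p q : cmd)
  | If (x : nat) (p q : cmd)          (* test x <> 0 *)
  | While (x : nat) (p : cmd).

Record state : Type := State { reg : nat -> nat; mem : nat -> nat -> nat }.

Definition trunc (w v : nat) : nat := v mod 2 ^ w.

(* Sub wraps around; division by 0 follows Nat.div and Nat.modulo. *)
Definition eval_op (w : nat) (o : binop) (x y : nat) : nat :=
  trunc w
    match o with
    | Add => x + y
    | Sub => x + 2 ^ w - y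
    | Mul => x * y
    | Div => x / y
    | Mod => x mod y
    | And => Nat.land x y
    | Or => Nat.lor x y
    | Xor => Nat.lxor x y
    | Shl => Nat.shiftl x y
    | Shr => Nat.shiftr x y
    | Ltb => Nat.b2n (x <? y)
    | Eqb => Nat.b2n (x =? y)
    end.

Definition upd {A : Type} (f : nat -> A) (i : nat) (v : A) : nat -> A :=
  fun j => if j =? i then v else f j.

Definition set_reg (s : state) (x v : nat) : state :=
  State (upd (reg s) x v) (mem s).

Definition set_mem (s : state) (a i v : nat) : state :=
  State (reg s) (upd (mem s) a (upd (mem s a) i v)).

(* exec w p s t s' : from s, p halts in state s' after t steps. *)
Inductive exec (w : nat) : cmd -> state -> nat -> state -> Prop :=
  | ESkip s : exec w Skip s 1 s
  | EConst s x c : exec w (Const x c) s 1 (set_reg s x (trunc w c))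
  | EOp s o x y z :
      exec w (Op o x y z) s 1 (set_reg s x (eval_op w o (reg s y) (reg s z)))
  | ERead s x a y :
      exec w (Read x a y) s 1 (set_reg s x (mem s a (reg s y)))
  | EWrite s a x y :
      exec w (Write a x y) s 1 (set_mem s a (reg s x) (reg s y))
  | ESeq s1 s2 s3 p q t1 t2 :
      exec w p s1 t1 s2 -> exec w q s2 t2 s3 ->
      exec w (Seq p q) s1 (t1 + t2) s3
  | EIfTrue s s' x p q t :
      reg s x <> 0 -> exec w p s t s' -> exec w (If x p q) s (S t) s'
  | EIfFalse s s' x p q t :
      reg s x = 0 -> exec w q s t s' -> exec w (If x p q) s (S t) s'
  | EWhileTrue s1 s2 s3 x p t1 t2 :
      reg s1 x <> 0 -> exec w p s1 t1 s2 -> exec w (While x p) s2 t2 s3 ->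
      exec w (While x p) s1 (S (t1 + t2)) s3
  | EWhileFalse s x p : reg s x = 0 -> exec w (While x p) s 1 s.

Definition input_array : nat := 0.
Definition output_array : nat := 1.

Definition init (w : nat) (input : list nat) : state :=
  State (fun _ => 0)
        (fun a i => if a =? input_array then trunc w (nth i input 0) else 0).

(* On the given input, p halts within time T leaving an output array that
   satisfies post. *)
Definition runs (w : nat) (p : cmd) (input : list nat) (T : R)
    (post : (nat -> nat) -> Prop) : Prop :=
  exists (t : nat) (s : state),
    exec w p (init w input) t s /\ (INR t <= T)%R /\ post (mem s output_array).

(* The literal (v, true) is the variable v and (v, false) its negation. *)
Definition literal : Set := nat * bool.
Definition clause : Set := list literal.

Record cnf : Set := Cnf { nvars : nat; clauses : list clause }.

(* Clauses form a set: a formula on n variables then has size polynomial in n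
   for fixed k, so that a time bound in n alone makes sense. *)
Definition is_kcnf (k : nat) (F : cnf) : Prop :=
  NoDup (clauses F) /\
  forall C, In C (clauses F) ->
    length C <= k /\ forall l, In l C -> fst l < nvars F.

Definition satisfiable (F : cnf) : Prop :=
  exists a : nat -> bool,
    forall C, In C (clauses F) -> exists l, In l C /\ a (fst l) = snd l.

Definition encode_literal (l : literal) : nat := 2 * fst l + Nat.b2n (snd l).

Definition encode_cnf (F : cnf) : list nat :=
  nvars F :: length (clauses F) ::
  flat_map (fun C => length C :: map encode_literal C) (clauses F).

(* Words have at least c * (n + 1) bits, the constant c being chosen with the
   program: O(n) bits are what addressing 2 ^ O(n) cells takes. *)
Definition kSAT_in_time (k : nat) (T : nat -> R) : Prop :=
  exists (p : cmd) (c : nat),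
  forall F : cnf, is_kcnf k F ->
  forall w : nat, c * (nvars F + 1) <= w ->
    runs w p (encode_cnf F) (T (nvars F))
      (fun out => (satisfiable F /\ out 0 = 1) \/ (~ satisfiable F /\ out 0 = 0)).

Definition big_O (f g : nat -> R) : Prop :=
  exists (C : R) (n0 : nat), forall n, n0 <= n -> (f n <= C * g n)%R.

Definition SETH : Prop :=
  forall delta : R, (delta < 1)%R ->
  exists k : nat,
    ~ exists T : nat -> R,
        big_O T (fun n => Rpower 2 (delta * INR n)) /\ kSAT_in_time k T.

(* Vertices are 0, ..., nverts - 1; an edge is ((u, v), weight). In the
   undirected case each edge is listed once, in either orientation. *)
Record graph : Set := Graph { nverts : nat; edges : list (nat * nat * nat) }.

Definition nedges (G : graph) : nat := length (edges G).

Definition is_graph (directed weighted : bool) (G : graph) : Prop :=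
  NoDup (map fst (edges G)) /\
  (forall u v c, In (u, v, c) (edges G) ->
     u < nverts G /\ v < nverts G /\ u <> v /\ (weighted = false -> c = 1)) /\
  (directed = false ->
     forall u v, In (u, v) (map fst (edges G)) -> ~ In (v, u) (map fst (edges G))).

Definition arc (directed : bool) (G : graph) (u v c : nat) : Prop :=
  In (u, v, c) (edges G) \/ (directed = false /\ In (v, u, c) (edges G)).

Inductive walk (directed : bool) (G : graph) : nat -> nat -> nat -> Prop :=
  | WalkNil u : walk directed G u u 0
  | WalkCons u v z c l :
      arc directed G u v c -> walk directed G v z l ->
      walk directed G u z (c + l).

(* Distances and eccentricities live in option nat, with None for infinity. *)
Definition ext_le (d e : option nat) : Prop :=
  match d, e with
  | _, None => True
  | None, Some _ => False
  | Some d, Some e => d <= e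
  end.

Definition is_dist (directed : bool) (G : graph) (x y : nat) (d : option nat) : Prop :=
  match d with
  | Some d => walk directed G x y d /\ forall l, walk directed G x y l -> d <= l
  | None => forall l, ~ walk directed G x y l
  end.

Definition is_ecc (directed : bool) (G : graph) (x : nat) (e : option nat) : Prop :=
  (exists y, y < nverts G /\ is_dist directed G x y e) /\
  forall y d, y < nverts G -> is_dist directed G x y d -> ext_le d e.

Definition encode_ext (d : option nat) : nat :=
  match d with None => 0 | Some d => S d end.

Definition encode_graph (weighted : bool) (G : graph) : list nat :=
  nverts G :: nedges G ::
  flat_map (fun '(u, v, c) => if weighted then [u; v; c] else [u; v]) (edges G).

Definition max_weight (G : graph) : nat := list_max (map snd (edges G)).

(* Words have at least c * log2 (n + W + 2) bits for the maximum weight W, the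
   constant c being chosen with the program. *)
Definition Eccentricities_in_time (directed weighted : bool)
    (g : nat -> nat -> R) : Prop :=
  exists (p : cmd) (c : nat),
  forall G : graph, is_graph directed weighted G ->
  forall w : nat, c * Nat.log2 (nverts G + max_weight G + 2) <= w ->
    runs w p (encode_graph weighted G) (g (nedges G) (nverts G))
      (fun out => forall x, x < nverts G ->
         exists e, is_ecc directed G x e /\ out x = encode_ext e).

(* The first argument of g is the number of edges, the second the number of
   vertices. *)
Definition sub_mn (g : nat -> nat -> R) : Prop :=
  exists alpha beta : R, (alpha + beta < 2)%R /\
  exists (C : R) (N : nat), forall m n : nat, N <= m -> N <= n ->
    (g m n <= C * (Rpower (INR m) alpha * Rpower (INR n) beta))%R.

(* Main.v *)
(** Split the [n] variables into two halves of [h = (n + 1) / 2] variables. Each of the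
    [2 * 2 ^ h] assignments of a half becomes a 0-1 vector indexed by the clauses, with a
    one at the clauses that it fails to satisfy. Two assignments of different halves
    together satisfy the formula if and only if their vectors are orthogonal.

    In the graph, a vector is joined to the coordinates where it has a one and to the hub
    of its half; each hub is joined to all coordinates and to the other hub. A vector [u]
    of the first half is then at distance at most 2 from every vertex outside the second
    half, and at distance 2 or 3 from a vector [v] of the second half: 3 if and only if
    they are orthogonal. So the formula is satisfiable if and only if some [u] has
    eccentricity 3.

    A k-CNF has polynomially many distinct clauses, so both the numbers of vertices and of
    edges lie between [2 ^ h] and [2 ^ h * poly n]; a bound [m ^ alpha * n ^ beta] becomes
    [2 ^ ((alpha + beta) * n / 2)] up to a polynomial, which is [O(2 ^ (delta * n))] for
    some [delta < 1]. The word RAM program that writes down the graph runs in time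
    [2 ^ h * poly n]; the given eccentricity program is called on it with registers and
    arrays renamed. *)

From Stdlib Require Import Reals RList Arith List Bool Lia Lra FunctionalExtensionality FinFun.
Require Import Defs.
Import ListNotations.

(** * Renaming registers and arrays *)

Lemma upd_same {A : Type} (f : nat -> A) i v : upd f i v i = v.
Proof. unfold upd. now rewrite Nat.eqb_refl. Qed.

Lemma upd_other {A : Type} (f : nat -> A) i v j : j <> i -> upd f i v j = f j.
Proof. intros H. unfold upd. now destruct (Nat.eqb_spec j i). Qed.

Lemma upd_embed {A : Type} (k : nat -> nat) (u u' : nat -> A) i v :
  Injective k -> (forall x, u' (k x) = u x) ->
  forall x, upd u' (k i) v (k x) = upd u i v x.
Proof.
  intros Hk Hu x. destruct (Nat.eq_dec x i) as [->|Hn].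
  - now rewrite !upd_same.
  - rewrite !upd_other; auto.
Qed.

Section Renaming.

Variables f g : nat -> nat.

Fixpoint rename (p : cmd) : cmd :=
  match p with
  | Skip => Skip
  | Const x c => Const (f x) c
  | Op o x y z => Op o (f x) (f y) (f z)
  | Read x a y => Read (f x) (g a) (f y)
  | Write a x y => Write (g a) (f x) (f y)
  | Seq p q => Seq (rename p) (rename q)
  | If x p q => If (f x) (rename p) (rename q)
  | While x p => While (f x) (rename p)
  end.

Definition embeds (s s' : state) : Prop :=
  (forall x, reg s' (f x) = reg s x) /\ (forall a, mem s' (g a) = mem s a).

Definition unchanged_off_range (s s' : state) : Prop :=
  (forall y, (forall x, y <> f x) -> reg s' y = reg s y) /\
  (forall b, (forall a, b <> g a) -> mem s' b = mem s b).

Hypotheses (f_inj : Injective f) (g_inj : Injective g).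

Lemma embeds_set_reg s s' x v :
  embeds s s' -> embeds (set_reg s x v) (set_reg s' (f x) v).
Proof. intros [Hr Hm]. split; [now apply upd_embed|exact Hm]. Qed.

Lemma embeds_set_mem s s' a i v :
  embeds s s' -> embeds (set_mem s a i v) (set_mem s' (g a) i v).
Proof.
  intros [Hr Hm]. split; [exact Hr|]. cbn. rewrite Hm. now apply upd_embed.
Qed.

Lemma unchanged_off_range_refl s : unchanged_off_range s s.
Proof. split; reflexivity. Qed.

Lemma unchanged_off_range_trans s1 s2 s3 :
  unchanged_off_range s1 s2 -> unchanged_off_range s2 s3 -> unchanged_off_range s1 s3.
Proof.
  intros [Hreg1 Hmem1] [Hreg2 Hmem2].
  split; intros; [rewrite Hreg2, Hreg1|rewrite Hmem2, Hmem1]; auto.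
Qed.

Lemma unchanged_off_range_set_reg s x v : unchanged_off_range s (set_reg s (f x) v).
Proof. split; [|reflexivity]. intros y Hy. apply upd_other, Hy. Qed.

Lemma unchanged_off_range_set_mem s a i v : unchanged_off_range s (set_mem s (g a) i v).
Proof. split; [reflexivity|]. intros b Hb. apply upd_other, Hb. Qed.

Lemma exec_rename w p s t s1 :
  exec w p s t s1 -> forall s', embeds s s' ->
  exists s1', exec w (rename p) s' t s1' /\ embeds s1 s1' /\ unchanged_off_range s' s1'.
Proof.
  induction 1 as [s|s x c|s o x y z|s x a y|s a x y|s1 s2 s3 p q t1 t2 _ IHp _ IHq
    |s s1 x p q t Hx _ IHp|s s1 x p q t Hx _ IHq
    |s1 s2 s3 x p t1 t2 Hx _ IHp _ IHloop|s x p Hx]; intros s' Hs; cbn [rename];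
    pose proof Hs as [Hr Hm].
  - exists s'. split; [constructor|auto using unchanged_off_range_refl].
  - eexists. split; [constructor|]. auto using embeds_set_reg, unchanged_off_range_set_reg.
  - eexists. split; [constructor|]. rewrite !Hr.
    auto using embeds_set_reg, unchanged_off_range_set_reg.
  - eexists. split; [constructor|]. rewrite Hr, Hm.
    auto using embeds_set_reg, unchanged_off_range_set_reg.
  - eexists. split; [constructor|]. rewrite !Hr.
    auto using embeds_set_mem, unchanged_off_range_set_mem.
  - destruct (IHp _ Hs) as (s2' & Hexec1 & Hemb1 & Hoff1),
      (IHq _ Hemb1) as (s3' & Hexec2 & Hemb2 & Hoff2).
    exists s3'. split; [econstructor; eauto|eauto using unchanged_off_range_trans].
  - destruct (IHp _ Hs) as (s1' & Hexec & Hemb).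
    exists s1'. split; [apply EIfTrue; [now rewrite Hr|exact Hexec]|exact Hemb].
  - destruct (IHq _ Hs) as (s1' & Hexec & Hemb).
    exists s1'. split; [apply EIfFalse; [now rewrite Hr|exact Hexec]|exact Hemb].
  - destruct (IHp _ Hs) as (s2' & Hexec1 & Hemb1 & Hoff1),
      (IHloop _ Hemb1) as (s3' & Hexec2 & Hemb2 & Hoff2).
    exists s3'. split; [|eauto using unchanged_off_range_trans].
    eapply EWhileTrue; [now rewrite Hr|exact Hexec1|exact Hexec2].
  - exists s'. split; [apply EWhileFalse; now rewrite Hr|auto using unchanged_off_range_refl].
Qed.

End Renaming.

Definition bounded (w : nat) (s : state) : Prop :=
  (forall x, reg s x < 2 ^ w) /\ (forall a i, mem s a i < 2 ^ w).

Lemma pow2_pos n : 0 < 2 ^ n.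
Proof. apply Nat.neq_0_lt_0, Nat.pow_nonzero. discriminate. Qed.

Lemma trunc_lt w v : trunc w v < 2 ^ w.
Proof. apply Nat.mod_upper_bound, Nat.pow_nonzero. discriminate. Qed.

Lemma trunc_small w v : v < 2 ^ w -> trunc w v = v.
Proof. apply Nat.mod_small. Qed.

Lemma upd_lt b (f : nat -> nat) i v j : (forall k, f k < b) -> v < b -> upd f i v j < b.
Proof. intros Hf Hv. unfold upd. destruct (j =? i); auto. Qed.

Lemma bounded_set_reg w s x v : bounded w s -> v < 2 ^ w -> bounded w (set_reg s x v).
Proof. intros [Hr Hm] Hv. split; [|exact Hm]. intros y. now apply upd_lt. Qed.

Lemma bounded_set_mem w s a i v : bounded w s -> v < 2 ^ w -> bounded w (set_mem s a i v).
Proof.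
  intros [Hr Hm] Hv. split; [exact Hr|]. intros b j. cbn. unfold upd at 1.
  destruct (b =? a); [now apply upd_lt|apply Hm].
Qed.

Lemma exec_bounded w p s t s' : exec w p s t s' -> bounded w s -> bounded w s'.
Proof.
  intros He. induction He; intros Hb; auto.
  - apply bounded_set_reg; auto using trunc_lt.
  - apply bounded_set_reg; auto. apply trunc_lt.
  - apply bounded_set_reg; auto. apply Hb.
  - apply bounded_set_mem; auto. apply Hb.
Qed.

Lemma bounded_init w input : bounded w (init w input).
Proof.
  split; cbn; [auto using pow2_pos|]. intros a i.
  destruct (a =? input_array); auto using trunc_lt, pow2_pos.
Qed.

Lemma trunc_nth w l i : (forall x, In x l -> x < 2 ^ w) -> trunc w (nth i l 0) = nth i l 0.
Proof.
  intros H. apply trunc_small.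
  destruct (nth_in_or_default i l 0) as [Hi| ->]; auto using pow2_pos.
Qed.

Lemma b2n_lt_pow2 b w : 0 < w -> Nat.b2n b < 2 ^ w.
Proof.
  intros Hw. assert (2 ^ 1 <= 2 ^ w) by (apply Nat.pow_le_mono_r; lia).
  destruct b; cbn [Nat.b2n Nat.pow] in *; lia.
Qed.

(** * Expressions *)

Inductive expr : Set :=
  | Var (x : nat)
  | Num (c : nat)
  | Bin (o : binop) (a b : expr)
  | Get (a : nat) (e : expr).

Declare Scope expr_scope.
Delimit Scope expr_scope with expr.
Bind Scope expr_scope with expr.
Notation "$ x" := (Var x) (at level 1, x at level 0, format "$ x") : expr_scope.
Infix "+" := (Bin Add) : expr_scope.
Infix "-" := (Bin Sub) : expr_scope.
Infix "*" := (Bin Mul) : expr_scope.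
Infix "/" := (Bin Div) : expr_scope.
Infix "mod" := (Bin Mod) : expr_scope.
Infix "<?" := (Bin Ltb) : expr_scope.
Infix "=?" := (Bin Eqb) : expr_scope.

Definition op_value (o : binop) (x y : nat) : nat :=
  match o with
  | Add => x + y
  | Sub => x - y
  | Mul => x * y
  | Div => x / y
  | Mod => x mod y
  | And => Nat.land x y
  | Or => Nat.lor x y
  | Xor => Nat.lxor x y
  | Shl => Nat.shiftl x y
  | Shr => Nat.shiftr x y
  | Ltb => Nat.b2n (x <? y)
  | Eqb => Nat.b2n (x =? y)
  end.

Fixpoint value (e : expr) (m : state) : nat :=
  match e with
  | Var x => reg m x
  | Num c => c
  | Bin o a b => op_value o (value a m) (value b m)
  | Get a e => mem m a (value e m)
  end.

Definition op_fits (w : nat) (o : binop) (x y : nat) : Prop :=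
  match o with
  | Sub => y <= x
  | Div | Mod | Shr => True
  | Ltb | Eqb => 0 < w
  | _ => op_value o x y < 2 ^ w
  end.

Fixpoint fits (w : nat) (e : expr) (m : state) : Prop :=
  match e with
  | Var _ => True
  | Num c => c < 2 ^ w
  | Bin o a b => fits w a m /\ fits w b m /\ op_fits w o (value a m) (value b m)
  | Get _ e => fits w e m
  end.

Fixpoint cost (e : expr) : nat :=
  match e with
  | Var _ | Num _ => 1
  | Bin _ a b => cost a + (cost b + 1)
  | Get _ e => cost e + 1
  end.

Lemma eval_op_fits w o x y :
  x < 2 ^ w -> y < 2 ^ w -> op_fits w o x y -> eval_op w o x y = op_value o x y.
Proof.
  intros Hx Hy Ho. unfold eval_op.
  destruct o; cbn [op_fits op_value] in *;
    try (apply trunc_small; auto using b2n_lt_pow2; fail).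
  - unfold trunc. replace (x + 2 ^ w - y) with (x - y + 1 * 2 ^ w) by lia.
    rewrite Nat.Div0.mod_add. apply Nat.mod_small. lia.
  - apply trunc_small. destruct y; [cbn; lia|].
    apply Nat.le_lt_trans with x; [|exact Hx]. apply Nat.Div0.div_le_upper_bound. lia.
  - apply trunc_small. destruct y; [exact Hx|].
    apply Nat.le_lt_trans with x; [|exact Hx]. apply Nat.Div0.mod_le.
  - apply trunc_small. rewrite Nat.shiftr_div_pow2.
    apply Nat.le_lt_trans with x; [|exact Hx]. apply Nat.Div0.div_le_upper_bound.
    pose proof (pow2_pos y). nia.
Qed.

(* Variables, temporaries and the registers of a subroutine occupy disjoint residue
   classes. *)
Definition var_reg (x : nat) : nat := 4 * x + 1.
Definition temp_reg (d : nat) : nat := 4 * d + 3.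
Definition sub_reg (x : nat) : nat := 2 * x.

Definition represents (w : nat) (s m : state) : Prop :=
  bounded w s /\ (forall x, reg s (var_reg x) = reg m x) /\ mem s = mem m.

Definition changes_temps_from (d : nat) (s s' : state) : Prop :=
  (forall y, (forall d', d <= d' -> y <> temp_reg d') -> reg s' y = reg s y) /\
  mem s' = mem s.

Lemma changes_temps_from_trans d s1 s2 s3 :
  changes_temps_from d s1 s2 -> changes_temps_from d s2 s3 -> changes_temps_from d s1 s3.
Proof.
  intros [Hreg1 Hmem1] [Hreg2 Hmem2].
  split; [intros y Hy; rewrite Hreg2, Hreg1; auto|congruence].
Qed.

Lemma changes_temps_from_weaken d d' s s' :
  d' <= d -> changes_temps_from d s s' -> changes_temps_from d' s s'.
Proof.
  intros Hd [Hreg Hmem]. split; [|exact Hmem].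
  intros y Hy. apply Hreg. intros i Hi. apply Hy. lia.
Qed.

Lemma changes_temps_from_set_reg d s v : changes_temps_from d s (set_reg s (temp_reg d) v).
Proof. split; [|reflexivity]. intros y Hy. apply upd_other. auto. Qed.

Lemma changes_temps_from_sub_reg d s s' x :
  changes_temps_from d s s' -> reg s' (sub_reg x) = reg s (sub_reg x).
Proof. intros [Hreg _]. apply Hreg. unfold sub_reg, temp_reg. lia. Qed.

Lemma represents_exec_temps w p d s t s' m :
  represents w s m -> exec w p s t s' -> changes_temps_from d s s' -> represents w s' m.
Proof.
  intros (Hb & Hr & Hm) Hexec [Hreg Hmem]. split; [exact (exec_bounded _ _ _ _ _ Hexec Hb)|].
  split; [|congruence]. intros x. rewrite Hreg; [apply Hr|]. unfold var_reg, temp_reg. lia.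
Qed.

(* The RAM has no move instruction: [Or] of a register with itself serves as one. *)
Fixpoint eval_into (d : nat) (e : expr) : cmd :=
  match e with
  | Var x => Op Or (temp_reg d) (var_reg x) (var_reg x)
  | Num c => Const (temp_reg d) c
  | Bin o a b =>
      Seq (eval_into d a)
        (Seq (eval_into (S d) b) (Op o (temp_reg d) (temp_reg d) (temp_reg (S d))))
  | Get a e => Seq (eval_into d e) (Read (temp_reg d) a (temp_reg d))
  end.

Lemma eval_or_diag w v : v < 2 ^ w -> eval_op w Or v v = v.
Proof. intros Hv. unfold eval_op. rewrite Nat.lor_diag. now apply trunc_small. Qed.

Lemma exec_eval_into_temps w m e : forall d s,
  represents w s m -> fits w e m ->
  exists s', exec w (eval_into d e) s (cost e) s' /\
    reg s' (temp_reg d) = value e m /\ changes_temps_from d s s'.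
Proof.
  induction e as [x|c|o a IHa b IHb|a e IHe]; intros d s Hs He;
    cbn [fits eval_into cost value] in *.
  - eexists. split; [constructor|]. split; [|apply changes_temps_from_set_reg].
    destruct Hs as ([Hb _] & Hr & _). cbn [set_reg reg].
    now rewrite upd_same, eval_or_diag, Hr.
  - eexists. split; [constructor|]. split; [|apply changes_temps_from_set_reg].
    cbn [set_reg reg]. now rewrite upd_same, trunc_small.
  - destruct He as (Ha & Hb & Ho).
    destruct (IHa d s Hs Ha) as (s1 & Hexec1 & Hval1 & Htemps1).
    pose proof (represents_exec_temps _ _ _ _ _ _ _ Hs Hexec1 Htemps1) as Hs1.
    destruct (IHb (S d) s1 Hs1 Hb) as (s2 & Hexec2 & Hval2 & Htemps2).
    pose proof (represents_exec_temps _ _ _ _ _ _ _ Hs1 Hexec2 Htemps2) as [[Hw _] _].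
    assert (Hval1' : reg s2 (temp_reg d) = value a m).
    { rewrite (proj1 Htemps2); [exact Hval1|]. unfold temp_reg. lia. }
    eexists. split; [econstructor; [exact Hexec1|econstructor; [exact Hexec2|constructor]]|].
    split.
    + cbn [set_reg reg]. rewrite upd_same, <- Hval1', <- Hval2. apply eval_op_fits; auto.
      now rewrite Hval1', Hval2.
    + eauto using changes_temps_from_trans, changes_temps_from_weaken,
        changes_temps_from_set_reg.
  - destruct (IHe d s Hs He) as (s1 & Hexec1 & Hval1 & Htemps1).
    pose proof (represents_exec_temps _ _ _ _ _ _ _ Hs Hexec1 Htemps1) as (_ & _ & Hm).
    eexists. split; [econstructor; [exact Hexec1|constructor]|]. split.
    + cbn [set_reg reg]. now rewrite upd_same, Hval1, Hm.
    + eauto using changes_temps_from_trans, changes_temps_from_set_reg.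
Qed.

Lemma exec_eval_into w m e d s :
  represents w s m -> fits w e m ->
  exists s', exec w (eval_into d e) s (cost e) s' /\ represents w s' m /\
    reg s' (temp_reg d) = value e m /\ changes_temps_from d s s'.
Proof.
  intros Hs He. destruct (exec_eval_into_temps w m e d s Hs He)
    as (s' & Hexec & Hval & Htemps).
  exists s'. split; [exact Hexec|]. split; [|auto].
  exact (represents_exec_temps _ _ _ _ _ _ _ Hs Hexec Htemps).
Qed.

(** * Programs *)

Definition Assign (x : nat) (e : expr) : cmd :=
  Seq (eval_into 0 e) (Op Or (var_reg x) (temp_reg 0) (temp_reg 0)).

Definition Put (a : nat) (e1 e2 : expr) : cmd :=
  Seq (eval_into 0 e1) (Seq (eval_into 1 e2) (Write a (temp_reg 0) (temp_reg 1))).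

Definition Cond (e : expr) (p q : cmd) : cmd :=
  Seq (eval_into 0 e) (If (temp_reg 0) p q).

Definition Loop (e : expr) (p : cmd) : cmd :=
  Seq (eval_into 0 e) (While (temp_reg 0) (Seq p (eval_into 0 e))).

Infix ";;" := Seq (at level 80, right associativity).
Notation "x ::= e" := (Assign x e%expr) (at level 78, e at level 75).

(* Programs keep loop variables at 0 outside their loops: the store between two
   statements is then a function of the data processed so far. *)
Definition For (x : nat) (e : expr) (p : cmd) : cmd :=
  Loop ($x <? e) (p;; x ::= $x + Num 1);; x ::= Num 0.

Definition Search (x : nat) (e test : expr) (found : nat) : cmd :=
  For x e (found ::= Bin Or ($found) test).

Definition halts_within (w : nat) (p : cmd) (s : state) (t : nat) (m : state) : Prop :=
  exists t' s', exec w p s t' s' /\ t' <= t /\ represents w s' m /\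
    forall x, reg s' (sub_reg x) = reg s (sub_reg x).

Definition computes (w : nat) (p : cmd) (m : state) (t : nat) (m' : state) : Prop :=
  forall s, represents w s m -> halts_within w p s t m'.

Lemma computes_skip w m : computes w Skip m 1 m.
Proof. intros s Hs. exists 1, s. split; [constructor|auto]. Qed.

Lemma computes_seq w p q m m1 m2 t1 t2 :
  computes w p m t1 m1 -> computes w q m1 t2 m2 -> computes w (p;; q) m (t1 + t2) m2.
Proof.
  intros Hp Hq s Hs.
  destruct (Hp s Hs) as (u1 & s1 & Hexec1 & Htime1 & Hrep1 & Hframe1).
  destruct (Hq s1 Hrep1) as (u2 & s2 & Hexec2 & Htime2 & Hrep2 & Hframe2).
  exists (u1 + u2), s2. split; [econstructor; eauto|]. split; [lia|].
  split; [exact Hrep2|congruence].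
Qed.

Lemma computes_weaken w p m t m' t' m'' :
  computes w p m t m' -> t <= t' -> m' = m'' -> computes w p m t' m''.
Proof.
  intros Hp Ht <- s Hs. destruct (Hp s Hs) as (u & s1 & Hexec & Htime & Hrep).
  exists u, s1. split; [exact Hexec|]. split; [lia|exact Hrep].
Qed.

Lemma computes_eval_seq w e p m t m' :
  fits w e m ->
  (forall s, represents w s m -> reg s (temp_reg 0) = value e m -> halts_within w p s t m') ->
  computes w (eval_into 0 e;; p) m (cost e + t) m'.
Proof.
  intros He Hp s Hs. destruct (exec_eval_into w m e 0 s Hs He)
    as (s1 & Hexec1 & Hrep1 & Hval1 & Htemps1).
  destruct (Hp s1 Hrep1 Hval1) as (u & s2 & Hexec2 & Htime2 & Hrep2 & Hframe2).
  exists (cost e + u), s2. split; [econstructor; eauto|]. split; [lia|].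
  split; [exact Hrep2|]. intros x. rewrite Hframe2. eapply changes_temps_from_sub_reg, Htemps1.
Qed.

Lemma computes_assign w x e m :
  fits w e m -> computes w (x ::= e) m (cost e + 1) (set_reg m x (value e m)).
Proof.
  intros He. apply computes_eval_seq; [exact He|]. intros s (Hb & Hr & Hm) Hv.
  eexists _, _. split; [constructor|]. split; [reflexivity|].
  pose proof (proj1 Hb (temp_reg 0)) as Hd. rewrite eval_or_diag by exact Hd.
  rewrite Hv in *. split; [split; [now apply bounded_set_reg|split; [|exact Hm]]|].
  - apply (upd_embed var_reg); [unfold Injective, var_reg; lia|exact Hr].
  - intros y. apply upd_other. unfold sub_reg, var_reg. lia.
Qed.

Lemma computes_put w a e1 e2 m :
  fits w e1 m -> fits w e2 m ->
  computes w (Put a e1 e2) m (cost e1 + (cost e2 + 1)) (set_mem m a (value e1 m) (value e2 m)).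
Proof.
  intros He1 He2. apply computes_eval_seq; [exact He1|]. intros s Hs Hval1.
  destruct (exec_eval_into w m e2 1 s Hs He2)
    as (s2 & Hexec2 & (Hb & Hr & Hm) & Hval2 & Htemps2).
  rewrite <- Hval1, <- Hval2, <- (proj1 Htemps2 (temp_reg 0)) by (unfold temp_reg; lia).
  eexists _, _. split; [econstructor; [exact Hexec2|constructor]|]. split; [reflexivity|].
  split; [split; [apply bounded_set_mem; [exact Hb|apply Hb]|split; [exact Hr|]]|].
  - cbn [set_mem mem]. now rewrite Hm.
  - intros x. exact (changes_temps_from_sub_reg _ _ _ x Htemps2).
Qed.

Lemma computes_cond w e p q m t m' :
  fits w e m ->
  (value e m <> 0 -> computes w p m t m') ->
  (value e m = 0 -> computes w q m t m') ->
  computes w (Cond e p q) m (cost e + S t) m'.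
Proof.
  intros He Hp Hq. apply computes_eval_seq; [exact He|]. intros s Hs Hv.
  destruct (Nat.eq_dec (value e m) 0) as [Hz|Hn].
  - destruct (Hq Hz s Hs) as (u & s' & Hexec & Htime & Hrep). exists (S u), s'.
    split; [apply EIfFalse; [congruence|exact Hexec]|split; [lia|exact Hrep]].
  - destruct (Hp Hn s Hs) as (u & s' & Hexec & Htime & Hrep). exists (S u), s'.
    split; [apply EIfTrue; [congruence|exact Hexec]|split; [lia|exact Hrep]].
Qed.

Lemma halts_while w e p t k : forall (m : nat -> state) s,
  (forall i, i <= k -> fits w e (m i)) ->
  (forall i, i < k -> value e (m i) <> 0) -> value e (m k) = 0 ->
  (forall i, i < k -> computes w p (m i) t (m (S i))) ->
  represents w s (m 0) -> reg s (temp_reg 0) = value e (m 0) ->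
  halts_within w (While (temp_reg 0) (p;; eval_into 0 e)) s (k * (t + cost e + 1) + 1) (m k).
Proof.
  induction k as [|k IH]; intros m s He Hn Hz Hp Hs Hv.
  - exists 1, s. split; [apply EWhileFalse; congruence|]. split; [lia|auto].
  - destruct (Hp 0 (Nat.lt_0_succ _) s Hs) as (u & s1 & Hexec1 & Htime1 & Hrep1 & Hframe1).
    destruct (exec_eval_into w _ e 0 s1 Hrep1 (He 1 ltac:(lia)))
      as (s2 & Hexec2 & Hrep2 & Hval2 & Htemps2).
    destruct (IH (fun i => m (S i)) s2) as (v & s3 & Hexec3 & Htime3 & Hrep3 & Hframe3); auto.
    + intros i Hi. apply He. lia.
    + intros i Hi. apply Hn. lia.
    + intros i Hi. apply Hp. lia.
    + exists (S ((u + cost e) + v)), s3. split.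
      { eapply EWhileTrue; [|econstructor; [exact Hexec1|exact Hexec2]|exact Hexec3].
        rewrite Hv. apply Hn. lia. }
      split; [lia|]. split; [exact Hrep3|]. intros x.
      rewrite Hframe3, (changes_temps_from_sub_reg _ _ _ x Htemps2). apply Hframe1.
Qed.

Lemma computes_loop w e p t k (m : nat -> state) :
  (forall i, i <= k -> fits w e (m i)) ->
  (forall i, i < k -> value e (m i) <> 0) -> value e (m k) = 0 ->
  (forall i, i < k -> computes w p (m i) t (m (S i))) ->
  computes w (Loop e p) (m 0) (cost e + (k * (t + cost e + 1) + 1)) (m k).
Proof.
  intros He Hn Hz Hp. apply computes_eval_seq; [apply He; lia|].
  intros s Hs Hv. now apply halts_while.
Qed.

Lemma state_ext s s' :
  (forall x, reg s x = reg s' x) -> (forall a i, mem s a i = mem s' a i) -> s = s'.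
Proof.
  destruct s as [r m], s' as [r' m']. cbn. intros Hr Hm.
  f_equal; [now extensionality x|]. extensionality a. now extensionality i.
Qed.

Lemma set_reg_set_reg s x u v : set_reg (set_reg s x u) x v = set_reg s x v.
Proof.
  apply state_ext; [|reflexivity]. intros y. cbn. unfold upd. now destruct (y =? x).
Qed.

Lemma set_reg_comm s x y u v :
  x <> y -> set_reg (set_reg s x u) y v = set_reg (set_reg s y v) x u.
Proof.
  intros Hn. apply state_ext; [|reflexivity]. intros z. cbn. unfold upd.
  destruct (Nat.eqb_spec z x), (Nat.eqb_spec z y); congruence.
Qed.

Lemma set_reg_same s x v : reg s x = v -> set_reg s x v = s.
Proof.
  intros <-. apply state_ext; [|reflexivity]. intros y. cbn.
  destruct (Nat.eq_dec y x) as [->|Hn]; [apply upd_same|now apply upd_other].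
Qed.

Lemma computes_for w x e p t k (m : nat -> state) :
  0 < w -> k < 2 ^ w ->
  (forall i, i <= k -> fits w e (set_reg (m i) x i) /\ value e (set_reg (m i) x i) = k) ->
  (forall i, i < k -> computes w p (set_reg (m i) x i) t (set_reg (m (S i)) x i)) ->
  reg (m 0) x = 0 -> reg (m k) x = 0 ->
  computes w (For x e p) (m 0) (k * (t + cost e + 7) + cost e + 5) (m k).
Proof.
  intros Hw Hk He Hp Hstart Hend. assert (Hone : 1 < 2 ^ w) by now apply (b2n_lt_pow2 true).
  assert (Hx : forall i v, reg (set_reg (m i) x v) x = v) by (intros; apply upd_same).
  eapply computes_weaken.
  - eapply computes_seq; [|apply computes_assign; cbn [fits]; lia].
    replace (m 0) with (set_reg (m 0) x 0) by now apply set_reg_same.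
    apply (computes_loop w _ _ (t + 4) k (fun i => set_reg (m i) x i)).
    + intros i Hi. cbn [fits op_fits]. split; [exact I|]. split; [now apply He|exact Hw].
    + intros i Hi. cbn [value op_value]. rewrite Hx, (proj2 (He i (Nat.lt_le_incl _ _ Hi))).
      destruct (Nat.ltb_spec i k); [discriminate|lia].
    + cbn [value op_value]. now rewrite Hx, (proj2 (He k (le_n _))), Nat.ltb_irrefl.
    + intros i Hi. eapply computes_seq; [now apply Hp|].
      eapply computes_weaken; [apply computes_assign| |].
      * cbn [fits op_fits value op_value]. rewrite Hx. lia.
      * cbn. lia.
      * cbn [value op_value]. rewrite Hx, set_reg_set_reg. f_equal. lia.
  - cbn [cost]. lia.
  - cbn [value]. rewrite set_reg_set_reg. now apply set_reg_same.
Qed.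

Lemma b2n_or a b : Nat.lor (Nat.b2n a) (Nat.b2n b) = Nat.b2n (a || b).
Proof. now destruct a, b. Qed.

Lemma computes_search w x e test found k m (P : nat -> bool) :
  0 < w -> k < 2 ^ w -> x <> found -> reg m x = 0 -> reg m found = 0 ->
  (forall i b, i <= k ->
     let m_i := set_reg (set_reg m found (Nat.b2n b)) x i in
     fits w e m_i /\ value e m_i = k) ->
  (forall i b, i < k ->
     let m_i := set_reg (set_reg m found (Nat.b2n b)) x i in
     fits w test m_i /\ value test m_i = Nat.b2n (P i)) ->
  computes w (Search x e test found) m (k * (cost test + cost e + 10) + cost e + 5)
    (set_reg m found (Nat.b2n (existsb P (seq 0 k)))).
Proof.
  intros Hw Hk Hn Hx Hf He Ht.
  set (mi := fun i => set_reg m found (Nat.b2n (existsb P (seq 0 i)))).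
  assert (Hmx : forall i, reg (mi i) x = 0)
    by (intros i; cbn; now rewrite upd_other by auto).
  change (set_reg m found _) with (mi k).
  replace m with (mi 0) at 1 by now apply set_reg_same.
  eapply computes_weaken; [apply (computes_for w x e _ (cost test + 3) k mi); auto| |auto].
  - intros i Hi. apply He, Hi.
  - intros i Hi. destruct (Ht i (existsb P (seq 0 i)) Hi) as [Hfits Hval].
    fold (mi i) in Hfits, Hval.
    assert (Hr : reg (set_reg (mi i) x i) found = Nat.b2n (existsb P (seq 0 i)))
      by (cbn; rewrite upd_other by auto; apply upd_same).
    eapply computes_weaken; [apply computes_assign| |].
    + cbn [fits op_fits value op_value]. rewrite Hr, Hval, b2n_or.
      split; [exact I|]. split; [exact Hfits|now apply b2n_lt_pow2].
    + cbn. lia.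
    + cbn [value op_value]. rewrite Hr, Hval, b2n_or. unfold mi.
      rewrite set_reg_comm, set_reg_set_reg by auto.
      rewrite seq_S, existsb_app. cbn. now rewrite orb_false_r.
  - lia.
Qed.

Lemma exec_call w p input m s t s' :
  represents w s m -> (forall x, reg s (sub_reg x) = 0) ->
  (forall a, mem m (S (S a)) = mem (init w input) a) ->
  exec w p (init w input) t s' ->
  exists s1, exec w (rename sub_reg (fun a => S (S a)) p) s t s1 /\
    represents w s1
      (State (reg m) (fun a => match a with S (S b) => mem s' b | _ => mem m a end)).
Proof.
  intros (Hb & Hr & Hm) Hz Hinput Hexec.
  assert (Hs : embeds sub_reg (fun a => S (S a)) (init w input) s).
  { split; [exact Hz|]. intros a. now rewrite Hm, Hinput. }
  assert (sub_inj : Injective sub_reg) by (unfold Injective, sub_reg; lia).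
  assert (array_inj : Injective (fun a => S (S a))) by (unfold Injective; lia).
  destruct (exec_rename _ _ sub_inj array_inj _ _ _ _ _ Hexec s Hs)
    as (s1 & Hexec1 & [_ Hm1] & [Hr1 Ho1]).
  exists s1. split; [exact Hexec1|]. split; [exact (exec_bounded _ _ _ _ _ Hexec1 Hb)|].
  split; cbn [reg mem].
  - intros x. rewrite Hr1; [apply Hr|]. unfold var_reg, sub_reg. lia.
  - extensionality a. destruct a as [|[|a]]; [| |apply Hm1];
      rewrite Ho1, Hm by lia; reflexivity.
Qed.

(** * Lists *)

Lemma length_flat_map_between {A B : Type} (f : A -> list B) a b l :
  (forall x, In x l -> a <= length (f x) <= b) ->
  length l * a <= length (flat_map f l) <= length l * b.
Proof.
  induction l as [|x l IH]; cbn [flat_map length]; intros H; [lia|].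
  rewrite length_app. pose proof (H x (or_introl eq_refl)).
  specialize (IH (fun y Hy => H y (or_intror Hy))). lia.
Qed.

Lemma flat_map_flat_map {A B C : Type} (f : A -> list B) (g : B -> list C) l :
  flat_map g (flat_map f l) = flat_map (fun x => flat_map g (f x)) l.
Proof. induction l as [|x l IH]; cbn; [reflexivity|]. now rewrite flat_map_app, IH. Qed.

Lemma NoDup_flat_map {A B : Type} (f : A -> list B) l :
  NoDup l -> (forall x, In x l -> NoDup (f x)) ->
  (forall x y b, In x l -> In y l -> In b (f x) -> In b (f y) -> x = y) ->
  NoDup (flat_map f l).
Proof.
  induction 1 as [|x l Hx Hl IH]; cbn; intros Hf Hd; [constructor|].
  apply NoDup_app; [auto| |].
  - apply IH; [auto|]. intros. eapply Hd; eauto.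
  - intros b Hb Hb'. apply in_flat_map in Hb' as (y & Hy & Hby). elim Hx.
    rewrite (Hd x y b); auto.
Qed.

Lemma nth_flat_map {A B : Type} (f : A -> list B) l j i a b :
  j < length l -> i < length (f (nth j l a)) ->
  nth (length (flat_map f (firstn j l)) + i) (flat_map f l) b = nth i (f (nth j l a)) b.
Proof.
  revert j. induction l as [|x l IH]; intros [|j] Hj Hi; cbn in *; try lia.
  - now apply app_nth1.
  - rewrite length_app, <- Nat.add_assoc, app_nth2_plus. apply IH; [lia|exact Hi].
Qed.

Lemma length_flat_map_firstn_S {A B : Type} (f : A -> list B) l j a :
  j < length l ->
  length (flat_map f (firstn (S j) l)) =
  length (flat_map f (firstn j l)) + length (f (nth j l a)).
Proof.
  revert j. induction l as [|x l IH]; intros [|j] Hj; cbn [length] in *; try lia.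
  - cbn. now rewrite app_nil_r.
  - rewrite !firstn_cons. cbn [flat_map nth]. rewrite !length_app, IH by lia. lia.
Qed.

Lemma length_flat_map_firstn_le {A B : Type} (f : A -> list B) l j :
  length (flat_map f (firstn j l)) <= length (flat_map f l).
Proof.
  rewrite <- (firstn_skipn j l) at 2. rewrite flat_map_app, length_app. lia.
Qed.

Lemma existsb_seq_nth {A : Type} (f : A -> bool) l d :
  existsb (fun i => f (nth i l d)) (seq 0 (length l)) = existsb f l.
Proof.
  apply eq_iff_eq_true. rewrite !existsb_exists. split.
  - intros (i & Hi & H). apply in_seq in Hi.
    exists (nth i l d). split; [apply nth_In; lia|exact H].
  - intros (x & Hx & H). destruct (In_nth l x d Hx) as (i & Hi & <-).
    exists i. split; [apply in_seq; lia|exact H].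
Qed.

Lemma flat_map_map {A B C : Type} (f : B -> list C) (g : A -> B) l :
  flat_map f (map g l) = flat_map (fun x => f (g x)) l.
Proof. now rewrite !flat_map_concat_map, map_map. Qed.

Lemma flat_map_filter {A B : Type} (f : A -> list B) P l :
  flat_map f (filter P l) = flat_map (fun x => if P x then f x else []) l.
Proof. induction l as [|x l IH]; cbn; [reflexivity|]. destruct (P x); cbn; now rewrite IH. Qed.

Fixpoint lists_up_to {A : Type} (k : nat) (l : list A) : list (list A) :=
  match k with
  | 0 => [[]]
  | S k => [] :: flat_map (fun t => map (fun a => a :: t) l) (lists_up_to k l)
  end.

Lemma in_lists_up_to {A : Type} (l : list A) k : forall t,
  length t <= k -> incl t l -> In t (lists_up_to k l).
Proof.
  induction k as [|k IH]; intros [|a t] Hk Ht; cbn in *; try lia; auto.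
  right. apply in_flat_map. exists t. apply incl_cons_inv in Ht as [Ha Ht].
  split; [apply IH; [lia|exact Ht]|apply in_map_iff; eauto].
Qed.

Lemma length_lists_up_to {A : Type} (l : list A) k :
  length (lists_up_to k l) <= (length l + 1) ^ k.
Proof.
  induction k as [|k IH]; [reflexivity|]. cbn [lists_up_to length].
  pose proof (length_flat_map_between (fun t => map (fun a => a :: t) l) 0 (length l)
    (lists_up_to k l)) as [_ H]; [intros; rewrite length_map; lia|].
  rewrite Nat.pow_succ_r'. pose proof (Nat.pow_nonzero (length l + 1) k). nia.
Qed.

(** * Graphs with unit weights *)

Definition adjacency_pairs (neighbours : nat -> list nat) (n : nat) : list (nat * nat) :=
  flat_map (fun u => map (pair u) (neighbours u)) (seq 0 n).

Lemma in_adjacency_pairs neighbours n u v :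
  In (u, v) (adjacency_pairs neighbours n) <-> u < n /\ In v (neighbours u).
Proof.
  unfold adjacency_pairs. rewrite in_flat_map. split.
  - intros (u' & Hu & H). apply in_map_iff in H as (v' & [= -> ->] & H).
    apply in_seq in Hu. split; [lia|exact H].
  - intros [Hu Hv]. exists u. split; [apply in_seq; lia|now apply in_map].
Qed.

Lemma NoDup_adjacency_pairs neighbours n :
  (forall u, NoDup (neighbours u)) -> NoDup (adjacency_pairs neighbours n).
Proof.
  intros Hd. apply NoDup_flat_map; [apply seq_NoDup| |].
  - intros u _. apply Injective_map_NoDup; [|apply Hd]. now intros v v' [=].
  - intros u u' [a b] _ _ H H'. apply in_map_iff in H as (? & [=] & _).
    apply in_map_iff in H' as (? & [=] & _). congruence.
Qed.

Definition orientations (directed : bool) (e : nat * nat) : list (nat * nat * nat) :=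
  (e, 1) :: if directed then [((snd e, fst e), 1)] else [].

Definition unit_graph (directed : bool) (n : nat) (E : list (nat * nat)) : graph :=
  Graph n (flat_map (orientations directed) E).

Definition adjacent (E : list (nat * nat)) (u v : nat) : Prop := In (u, v) E \/ In (v, u) E.

Lemma adjacent_sym E u v : adjacent E u v -> adjacent E v u.
Proof. unfold adjacent. tauto. Qed.

Section UnitGraph.

Variables (directed : bool) (n : nat) (E : list (nat * nat)).

Lemma in_orientations u v c e :
  In (u, v, c) (orientations directed e) <->
  c = 1 /\ (e = (u, v) \/ (directed = true /\ e = (v, u))).
Proof.
  destruct e as [a b]. unfold orientations. cbn [fst snd In]. split.
  - intros [[= <- <- <-]|H]; [auto|]. destruct directed; [|destruct H].
    destruct H as [[= <- <- <-]|[]]. auto.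
  - intros (-> & [[= <- <-]|[-> [= <- <-]]]); [now left|right; now left].
Qed.

Lemma in_edges_unit_graph u v c :
  In (u, v, c) (edges (unit_graph directed n E)) <->
  c = 1 /\ (In (u, v) E \/ (directed = true /\ In (v, u) E)).
Proof.
  cbn [edges unit_graph]. rewrite in_flat_map. split.
  - intros (e & He & H). apply in_orientations in H as (-> & [-> |[Hd ->]]); auto.
  - intros (-> & [H|[Hd H]]); [exists (u, v)|exists (v, u)]; rewrite in_orientations; auto.
Qed.

Lemma arc_unit_graph u v c :
  arc directed (unit_graph directed n E) u v c <-> c = 1 /\ adjacent E u v.
Proof.
  unfold arc, adjacent. rewrite !in_edges_unit_graph. destruct directed; intuition discriminate.
Qed.

Lemma walk_unit_step u v y l :
  adjacent E u v -> walk directed (unit_graph directed n E) v y l ->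
  walk directed (unit_graph directed n E) u y (S l).
Proof.
  intros H Hw. apply (WalkCons _ _ u v y 1 l); [now apply arc_unit_graph|exact Hw].
Qed.

Lemma walk_unit_edge u v :
  adjacent E u v -> walk directed (unit_graph directed n E) u v 1.
Proof. intros H. apply walk_unit_step with v; [exact H|constructor]. Qed.

Lemma walk_unit_inv u y l :
  walk directed (unit_graph directed n E) u y l ->
  (l = 0 /\ u = y) \/
  (exists v l', l = S l' /\ adjacent E u v /\ walk directed (unit_graph directed n E) v y l').
Proof.
  destruct 1 as [u|u v y c l Ha Hw]; [now left|right].
  apply arc_unit_graph in Ha as [-> Ha]. exists v, l. auto.
Qed.

Lemma max_weight_unit_graph : max_weight (unit_graph directed n E) <= 1.
Proof.
  unfold max_weight. apply list_max_le, Forall_forall. intros c H.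
  apply in_map_iff in H as ([[u v] c'] & <- & H).
  apply in_edges_unit_graph in H as [-> _]. reflexivity.
Qed.

Lemma nedges_unit_graph :
  length E <= nedges (unit_graph directed n E) <= 2 * length E.
Proof.
  unfold nedges, unit_graph. cbn [edges].
  pose proof (length_flat_map_between (orientations directed) 1 2 E) as H.
  rewrite Nat.mul_1_r, Nat.mul_comm in H. apply H.
  intros e _. unfold orientations. destruct directed; cbn; lia.
Qed.

Hypothesis E_increasing : forall u v, In (u, v) E -> u < v < n.

Lemma NoDup_arcs_unit_graph : NoDup E -> NoDup (map fst (edges (unit_graph directed n E))).
Proof.
  intros HE. cbn [edges unit_graph].
  rewrite flat_map_concat_map, concat_map, map_map, <- flat_map_concat_map.
  apply NoDup_flat_map; [exact HE| |].
  - intros [u v] H. apply E_increasing in H.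
    destruct directed; cbn; [|repeat constructor; intros []].
    constructor; [|repeat constructor; intros []]. intros [[=]|[]]. lia.
  - intros [u v] [u' v'] [a b] H H' Hm Hm'. apply E_increasing in H, H'.
    apply in_map_iff in Hm as ([[? ?] c] & [= -> ->] & Hm).
    apply in_map_iff in Hm' as ([[? ?] c'] & [= -> ->] & Hm').
    apply in_orientations in Hm as (_ & [[= -> ->]|[_ [= -> ->]]]),
      Hm' as (_ & [[= -> ->]|[_ [= -> ->]]]); auto; lia.
Qed.

Lemma is_graph_unit_graph weighted :
  NoDup E -> is_graph directed weighted (unit_graph directed n E).
Proof.
  intros HE. split; [now apply NoDup_arcs_unit_graph|]. split.
  - intros u v c H. apply in_edges_unit_graph in H as (-> & H). cbn [nverts unit_graph].
    destruct H as [H|[_ H]]; apply E_increasing in H; lia.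
  - intros Hd u v H H'.
    apply in_map_iff in H as ([[? ?] c] & [= -> ->] & H).
    apply in_map_iff in H' as ([[? ?] c'] & [= -> ->] & H').
    apply in_edges_unit_graph in H as (_ & [H|[? _]]); [|congruence].
    apply in_edges_unit_graph in H' as (_ & [H'|[? _]]); [|congruence].
    apply E_increasing in H, H'. lia.
Qed.

End UnitGraph.

(** * The graph of an orthogonal vectors instance *)

Lemma half_cases N s : s < 2 * N -> (s / N = 0 /\ s < N) \/ (s / N = 1 /\ N <= s).
Proof.
  intros H. destruct (Nat.lt_ge_cases s N) as [L|L]; [left|right]; split; auto.
  - now apply Nat.div_small.
  - symmetry. apply Nat.div_unique with (s - N); lia.
Qed.

(* The [2 * N] vectors, [N] on each side, come first, then the [M] coordinates, then
   one hub for each side; [R u j] says that vector [u] has a one at coordinate [j]. *)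
Section OrthogonalVectors.

Variables (N M : nat) (R : nat -> nat -> bool).

Definition orthogonal (u v : nat) : Prop := forall j, j < M -> R u j && R v j = false.

Definition coordinate (j : nat) : nat := 2 * N + j.
Definition hub (i : nat) : nat := 2 * N + M + i.

Definition upper_neighbours (u : nat) : list nat :=
  if u <? 2 * N then map coordinate (filter (R u) (seq 0 M)) ++ [hub (u / N)]
  else if u <? 2 * N + M then [hub 0; hub 1]
  else [hub 1].

Definition ov_edges : list (nat * nat) := adjacency_pairs upper_neighbours (2 * N + M + 1).

Definition ov_graph (directed : bool) : graph :=
  unit_graph directed (2 * N + M + 2) ov_edges.

Inductive ov_edge : nat -> nat -> Prop :=
  | VectorCoordinate u j : u < 2 * N -> j < M -> R u j = true -> ov_edge u (coordinate j)
  | VectorHub u : u < 2 * N -> ov_edge u (hub (u / N))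
  | CoordinateHub j i : j < M -> i < 2 -> ov_edge (coordinate j) (hub i)
  | HubHub : ov_edge (hub 0) (hub 1).

Lemma in_ov_edges u v : In (u, v) ov_edges <-> ov_edge u v.
Proof.
  unfold ov_edges, upper_neighbours. rewrite in_adjacency_pairs. split.
  - intros [Hu Hv]. destruct (Nat.ltb_spec u (2 * N)) as [Hvector|Hother];
      [|destruct (Nat.ltb_spec u (2 * N + M)) as [Hcoord|Hhub]].
    + apply in_app_iff in Hv as [Hv|[<-|[]]]; [|now constructor].
      apply in_map_iff in Hv as (j & <- & Hj). apply filter_In in Hj as [Hj HR].
      apply in_seq in Hj. constructor; [exact Hvector|lia|exact HR].
    + replace u with (coordinate (u - 2 * N)) by (unfold coordinate; lia).
      destruct Hv as [<-|[<-|[]]]; constructor; lia.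
    + destruct Hv as [<-|[]]. replace u with (hub 0) by (unfold hub; lia). constructor.
  - intros He. destruct He as [u j Hu Hj HR|u Hu|j i Hj Hi|].
    + rewrite (proj2 (Nat.ltb_lt _ _) Hu). split; [lia|]. apply in_app_iff. left.
      apply in_map, filter_In. split; [apply in_seq; lia|exact HR].
    + rewrite (proj2 (Nat.ltb_lt _ _) Hu). split; [lia|]. apply in_app_iff. right. now left.
    + unfold coordinate.
      rewrite (proj2 (Nat.ltb_ge _ _)), (proj2 (Nat.ltb_lt _ _)) by lia.
      split; [lia|]. destruct i as [|[|i]]; cbn; [auto|auto|lia].
    + replace (hub 0) with (2 * N + M) by (unfold hub; lia).
      rewrite (proj2 (Nat.ltb_ge _ _)), (proj2 (Nat.ltb_ge _ _)) by lia.
      split; [lia|now left].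
Qed.

Lemma ov_edge_increasing u v : ov_edge u v -> u < v < 2 * N + M + 2.
Proof.
  destruct 1 as [u j Hu Hj HR|u Hu|j i Hj Hi|]; unfold coordinate, hub; try lia.
  destruct (half_cases N u Hu) as [[-> ?]|[-> ?]]; lia.
Qed.

Lemma NoDup_upper_neighbours u : NoDup (upper_neighbours u).
Proof.
  unfold upper_neighbours. destruct (u <? 2 * N); [|destruct (u <? 2 * N + M)].
  - apply NoDup_app; [|repeat constructor; intros []|].
    + apply Injective_map_NoDup; [|apply NoDup_filter, seq_NoDup].
      unfold Injective, coordinate. lia.
    + intros v Hv [<-|[]]. apply in_map_iff in Hv as (j & E & Hj).
      apply filter_In in Hj as [Hj _]. apply in_seq in Hj. unfold coordinate, hub in E. lia.
  - constructor; [|repeat constructor; intros []]. unfold hub. intros [E|[]]. lia.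
  - repeat constructor. intros [].
Qed.

Lemma is_graph_ov_graph directed weighted : is_graph directed weighted (ov_graph directed).
Proof.
  apply is_graph_unit_graph.
  - intros u v H. now apply ov_edge_increasing, in_ov_edges.
  - apply NoDup_adjacency_pairs, NoDup_upper_neighbours.
Qed.

Lemma max_weight_ov_graph directed : max_weight (ov_graph directed) <= 1.
Proof. apply max_weight_unit_graph. Qed.

Lemma length_upper_neighbours u :
  u < 2 * N + M + 1 -> 1 <= length (upper_neighbours u) <= M + 1.
Proof.
  intros Hu. unfold upper_neighbours.
  destruct (Nat.ltb_spec u (2 * N)); [|destruct (Nat.ltb_spec u (2 * N + M))].
  - rewrite length_app, length_map. pose proof (filter_length_le (R u) (seq 0 M)) as Hfilter.
    rewrite length_seq in Hfilter. cbn [length]. lia.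
  - cbn [length]. lia.
  - cbn [length]. lia.
Qed.

Lemma nedges_ov_graph directed :
  2 * N + M + 1 <= nedges (ov_graph directed) <= 2 * (2 * N + M + 1) * (M + 1).
Proof.
  pose proof (nedges_unit_graph directed (2 * N + M + 2) ov_edges) as Hg.
  fold (ov_graph directed) in Hg.
  enough (2 * N + M + 1 <= length ov_edges <= (2 * N + M + 1) * (M + 1)) by lia.
  pose proof (length_flat_map_between (fun u => map (pair u) (upper_neighbours u)) 1 (M + 1)
                (seq 0 (2 * N + M + 1))) as H.
  rewrite length_seq, Nat.mul_1_r in H. apply H.
  intros u Hu. apply in_seq in Hu. rewrite length_map. now apply length_upper_neighbours.
Qed.

Lemma adjacent_ov_edge u v : ov_edge u v -> adjacent ov_edges u v.
Proof. left. now apply in_ov_edges. Qed.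

Lemma adjacent_vector u v :
  u < 2 * N -> adjacent ov_edges u v ->
  (exists j, j < M /\ v = coordinate j /\ R u j = true) \/ v = hub (u / N).
Proof.
  intros Hu [H|H]; apply in_ov_edges in H; inversion H; subst; unfold coordinate, hub in *;
    try lia; eauto.
Qed.

Section Eccentricity.

Variables (directed : bool) (u : nat).
Hypothesis u_lt : u < N.

Lemma first_vector_hub v : v < N -> ov_edge v (hub 0).
Proof. intros Hv. rewrite <- (Nat.div_small v N Hv). apply VectorHub. lia. Qed.

Lemma second_vector_hub v : N <= v < 2 * N -> ov_edge v (hub 1).
Proof.
  intros Hv. replace 1 with (v / N); [apply VectorHub; lia|].
  destruct (half_cases N v) as [[_ ?]|[? _]]; lia.
Qed.

Lemma walk_near y :
  y < 2 * N + M + 2 -> ~ N <= y < 2 * N ->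
  exists l, l <= 2 /\ walk directed (ov_graph directed) u y l.
Proof.
  intros Hy Hn. pose proof (adjacent_ov_edge _ _ (first_vector_hub u u_lt)) as Hu.
  destruct (Nat.eq_dec y (hub 0)) as [-> |Hhub].
  { exists 1. split; [lia|]. now apply walk_unit_edge. }
  exists 2. split; [lia|]. apply walk_unit_step with (hub 0); [exact Hu|].
  apply walk_unit_edge. unfold hub in Hhub.
  destruct (Nat.lt_ge_cases y N) as [Hfirst|Hfirst].
  { now apply adjacent_sym, adjacent_ov_edge, first_vector_hub. }
  destruct (Nat.lt_ge_cases y (2 * N + M)) as [Hcoord|Hcoord].
  - apply adjacent_sym, adjacent_ov_edge.
    replace y with (coordinate (y - 2 * N)) by (unfold coordinate; lia).
    apply CoordinateHub; lia.
  - apply adjacent_ov_edge. replace y with (hub 1) by (unfold hub; lia). apply HubHub.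
Qed.

Lemma walk_far v : N <= v < 2 * N -> walk directed (ov_graph directed) u v 3.
Proof.
  intros Hv. apply walk_unit_step with (hub 0); [now apply adjacent_ov_edge, first_vector_hub|].
  apply walk_unit_step with (hub 1); [apply adjacent_ov_edge, HubHub|].
  now apply walk_unit_edge, adjacent_sym, adjacent_ov_edge, second_vector_hub.
Qed.

Lemma walk_common_coordinate v j :
  N <= v < 2 * N -> j < M -> R u j && R v j = true ->
  walk directed (ov_graph directed) u v 2.
Proof.
  intros Hv Hj H. apply andb_true_iff in H as [Hu Hv'].
  apply walk_unit_step with (coordinate j); [|apply walk_unit_edge, adjacent_sym];
    apply adjacent_ov_edge, VectorCoordinate; auto; lia.
Qed.

Lemma orthogonal_walk v l :
  N <= v < 2 * N -> orthogonal u v -> walk directed (ov_graph directed) u v l -> 3 <= l.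
Proof.
  intros Hv Ho Hw. destruct (half_cases N v) as [[_ ?]|[Hside _]]; try lia.
  apply walk_unit_inv in Hw as [[_ <-]|(a & l1 & -> & Ha & Hw)]; [lia|].
  apply adjacent_vector in Ha; [|lia]. rewrite (Nat.div_small u N) in Ha by exact u_lt.
  apply walk_unit_inv in Hw as [[_ <-]|(b & l2 & -> & Hb & Hw)].
  { unfold coordinate, hub in Ha. destruct Ha as [(j & Hj & -> & _)| ->]; lia. }
  apply walk_unit_inv in Hw as [[_ ->]|(? & ? & -> & _)]; [|lia].
  apply adjacent_sym, adjacent_vector in Hb; [|lia]. rewrite Hside in Hb.
  unfold coordinate, hub in Ha, Hb.
  destruct Ha as [(j & Hj & -> & HR)| ->], Hb as [(j' & Hj' & E & HR')|E]; try lia.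
  assert (j' = j) as -> by lia. specialize (Ho j Hj). now rewrite HR, HR' in Ho.
Qed.

Lemma ecc_three_iff e :
  is_ecc directed (ov_graph directed) u e ->
  (e = Some 3 <-> exists v, N <= v < 2 * N /\ orthogonal u v).
Proof.
  intros [(y & Hy & Hd) Hmax]. cbn [nverts ov_graph unit_graph] in Hy, Hmax.
  assert (N <= y < 2 * N \/ ~ N <= y < 2 * N) as Hside by lia. split.
  - intros ->. destruct Hd as [_ Hmin], Hside as [H|H].
    + exists y. split; [exact H|]. intros j Hj. apply not_true_is_false. intros HR.
      specialize (Hmin 2 (walk_common_coordinate y j H Hj HR)). lia.
    + destruct (walk_near y Hy H) as (l & Hl & Hw). specialize (Hmin l Hw). lia.
  - intros (v & Hv & Ho).
    assert (Hfar : ext_le (Some 3) e).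
    { apply (Hmax v); [lia|]. split; [now apply walk_far|].
      intros l. now apply orthogonal_walk. }
    assert (exists l, l <= 3 /\ walk directed (ov_graph directed) u y l) as (l & Hl & Hw).
    { destruct Hside as [H|H]; [exists 3; auto using walk_far|].
      destruct (walk_near y Hy H) as (l & Hl & Hw). exists l. split; [lia|exact Hw]. }
    destruct e as [d|]; [|now elim (Hd l)]. destruct Hd as [_ Hmin].
    specialize (Hmin l Hw). cbn in Hfar. f_equal. lia.
Qed.

End Eccentricity.

End OrthogonalVectors.

(** * Satisfiability as an orthogonal vectors problem *)

(* A number [s < 2 * 2 ^ h] is a partial assignment of [2 * h] variables: bit [h] tells
   which half of them it assigns, the lower bits are the values. *)
Definition lit_true (h s : nat) (l : literal) : bool :=
  (fst l / h =? s / 2 ^ h) && eqb (Nat.testbit s (fst l mod h)) (snd l).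

Definition falsifies (h s : nat) (C : clause) : bool := negb (existsb (lit_true h s) C).

Definition falsified_clause (h : nat) (Cs : list clause) (s j : nat) : bool :=
  falsifies h s (nth j Cs []).

Definition joint_assignment (h u v x : nat) : bool :=
  Nat.testbit (if x <? h then u else v) (x mod h).

Definition clause_true (a : nat -> bool) (C : clause) : bool :=
  existsb (fun l => eqb (a (fst l)) (snd l)) C.

Lemma nat_with_bits (f : nat -> bool) q h :
  exists s, s / 2 ^ h = q /\ forall i, i < h -> Nat.testbit s i = f i.
Proof.
  revert f. induction h as [|h IH]; intros f.
  - exists q. split; [apply Nat.div_1_r|lia].
  - destruct (IH (fun i => f (S i))) as (s & Hs & Hb).
    exists (2 * s + Nat.b2n (f 0)). split.
    + rewrite Nat.pow_succ_r', <- Nat.Div0.div_div, <- Hs. f_equal.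
      symmetry. apply Nat.div_unique with (Nat.b2n (f 0)); [|reflexivity].
      destruct (f 0); cbn; lia.
    + intros [|i] Hi; [apply Nat.testbit_0_r|].
      rewrite Nat.testbit_succ_r. apply Hb. lia.
Qed.

Section Halves.

Variables (h u v : nat).
Hypotheses (u_first : u < 2 ^ h) (v_second : 2 ^ h <= v < 2 * 2 ^ h).

Lemma lit_true_joint l :
  fst l < 2 * h ->
  lit_true h u l || lit_true h v l = eqb (joint_assignment h u v (fst l)) (snd l).
Proof.
  intros Hl. unfold lit_true, joint_assignment. rewrite (Nat.div_small u) by exact u_first.
  destruct (half_cases (2 ^ h) v) as [[_ ?]|[-> _]]; [lia|lia|].
  destruct (half_cases h (fst l) Hl) as [[-> ?]|[-> ?]];
    destruct (Nat.ltb_spec (fst l) h); try lia; cbn; now rewrite ?orb_false_r.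
Qed.

Lemma falsifies_joint C :
  (forall l, In l C -> fst l < 2 * h) ->
  falsifies h u C && falsifies h v C = negb (clause_true (joint_assignment h u v) C).
Proof.
  unfold falsifies, clause_true. rewrite <- negb_orb. intros HC. f_equal.
  induction C as [|l C IH]; [reflexivity|]. cbn [existsb].
  rewrite <- lit_true_joint, <- IH by (intros; apply HC; cbn; auto).
  destruct (lit_true h u l), (lit_true h v l); cbn; now rewrite ?orb_true_r.
Qed.

End Halves.

Lemma joint_assignment_surjective h (a : nat -> bool) :
  exists u v, u < 2 ^ h /\ 2 ^ h <= v < 2 * 2 ^ h /\
    forall x, x < 2 * h -> joint_assignment h u v x = a x.
Proof.
  pose proof (pow2_pos h).
  destruct (nat_with_bits a 0 h) as (u & Hu & Bu).
  destruct (nat_with_bits (fun i => a (h + i)) 1 h) as (v & Hv & Bv).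
  exists u, v.
  pose proof (Nat.div_mod_eq u (2 ^ h)). pose proof (Nat.mod_upper_bound u (2 ^ h)).
  pose proof (Nat.div_mod_eq v (2 ^ h)). pose proof (Nat.mod_upper_bound v (2 ^ h)).
  rewrite Hu in *. rewrite Hv in *. split; [lia|]. split; [lia|].
  intros x Hx. unfold joint_assignment.
  pose proof (Nat.div_mod_eq x h). pose proof (Nat.mod_upper_bound x h).
  destruct (half_cases h x Hx) as [[Hq ?]|[Hq ?]]; rewrite Hq in *;
    destruct (Nat.ltb_spec x h); try lia; [rewrite Bu|rewrite Bv]; try lia; f_equal; lia.
Qed.

Lemma satisfies_iff_clause_true (a : nat -> bool) C :
  (exists l, In l C /\ a (fst l) = snd l) <-> clause_true a C = true.
Proof.
  unfold clause_true. rewrite existsb_exists.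
  split; intros (l & Hl & H); exists l; (split; [exact Hl|now apply eqb_true_iff]).
Qed.

Lemma satisfiable_iff_orthogonal F h :
  (forall C, In C (clauses F) -> forall l, In l C -> fst l < 2 * h) ->
  (satisfiable F <->
   exists u v, u < 2 ^ h /\ 2 ^ h <= v < 2 * 2 ^ h /\
     orthogonal (length (clauses F)) (falsified_clause h (clauses F)) u v).
Proof.
  intros Hvar. unfold orthogonal, falsified_clause. split.
  - intros [a Ha]. destruct (joint_assignment_surjective h a) as (u & v & Hu & Hv & Huv).
    exists u, v. split; [exact Hu|]. split; [exact Hv|]. intros j Hj.
    pose proof (nth_In (clauses F) [] Hj) as HC.
    rewrite falsifies_joint by eauto. apply negb_false_iff, satisfies_iff_clause_true.
    destruct (Ha _ HC) as (l & Hl & Hal). exists l. split; [exact Hl|].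
    rewrite Huv; eauto.
  - intros (u & v & Hu & Hv & Ho). exists (joint_assignment h u v). intros C HC.
    apply satisfies_iff_clause_true, negb_false_iff.
    rewrite <- falsifies_joint by eauto.
    destruct (In_nth (clauses F) C [] HC) as (j & Hj & <-). now apply Ho.
Qed.

Lemma kcnf_num_clauses k F :
  is_kcnf k F -> length (clauses F) <= (2 * nvars F + 1) ^ k.
Proof.
  intros [Hd Hc].
  set (literals := list_prod (seq 0 (nvars F)) [true; false]).
  replace (2 * nvars F) with (length literals)
    by (unfold literals; rewrite length_prod, length_seq; cbn; lia).
  eapply Nat.le_trans; [|apply length_lists_up_to].
  apply NoDup_incl_length; [exact Hd|]. intros C HC.
  destruct (Hc C HC) as [Hk Hv]. apply in_lists_up_to; [exact Hk|].
  intros [x b] Hx. specialize (Hv _ Hx). cbn [fst] in Hv.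
  apply in_prod; [apply in_seq; lia|]. destruct b; cbn; auto.
Qed.

Definition listed (vs : list nat) (A : nat -> nat -> nat) : state :=
  State (fun x => nth x vs 0) A.

Fixpoint set_nth (x v : nat) (l : list nat) : list nat :=
  match x with
  | 0 => v :: tl l
  | S x => hd 0 l :: set_nth x v (tl l)
  end.

Lemma nth_set_nth x v l y : nth y (set_nth x v l) 0 = upd (fun y => nth y l 0) x v y.
Proof.
  revert l y. induction x as [|x IH]; intros [|u l] [|y]; cbn; try reflexivity.
  - now destruct y.
  - rewrite IH. unfold upd. cbn. now destruct (y =? x), y.
  - apply IH.
Qed.

Lemma set_reg_listed vs A x v : set_reg (listed vs A) x v = listed (set_nth x v vs) A.
Proof.
  apply state_ext; [|reflexivity]. intros y. symmetry. apply nth_set_nth.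
Qed.

(* Array [a] of the subroutine is array [a + 2] of the program. *)
Definition graph_array : nat := 2.
Definition ecc_array : nat := 3.

Definition layout (input L : list nat) : nat -> nat -> nat :=
  fun a i => match a with 0 => nth i input 0 | 2 => nth i L 0 | _ => 0 end.

Lemma layout_set_nth input L i v :
  upd (layout input L) graph_array (upd (layout input L graph_array) i v) =
  layout input (set_nth i v L).
Proof.
  extensionality a. extensionality i'. destruct a as [|[|[|a]]]; try reflexivity.
  symmetry. apply nth_set_nth.
Qed.

Lemma length_set_nth x v l : x < length l -> length (set_nth x v l) = length l.
Proof.
  revert l. induction x as [|x IH]; intros [|u l] Hx; cbn in *; try lia.
  rewrite IH; lia.
Qed.

Lemma set_nth_length v l : set_nth (length l) v l = l ++ [v].
Proof. induction l as [|u l IH]; cbn; [reflexivity|now rewrite IH]. Qed.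

Lemma init_listed w input :
  (forall x, In x input -> x < 2 ^ w) -> init w input = listed [] (layout input []).
Proof.
  intros Hin. apply state_ext; [now intros [|x]|]. intros [|[|[|a]]] i; try reflexivity.
  - now apply trunc_nth.
  - now destruct i.
Qed.

(** * Writing the edges of a graph *)

Local Notation num_clauses := 0 (only parsing).
Local Notation half_vars := 1 (only parsing).
Local Notation half_size := 2 (only parsing).
Local Notation vertex := 3 (only parsing).
Local Notation clause_index := 4 (only parsing).
Local Notation literal_index := 5 (only parsing).
Local Notation clause_pos := 6 (only parsing).
Local Notation clause_holds := 7 (only parsing).
Local Notation written := 8 (only parsing).
Local Notation answer := 9 (only parsing).

Definition emit (e : expr) : cmd :=
  Put graph_array ($written) e;; written ::= $written + Num 1.

Definition arc_words (weighted : bool) (e : nat * nat * nat) : list nat :=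
  let '(u, v, c) := e in if weighted then [u; v; c] else [u; v].

Lemma length_flat_map_arc_words weighted l :
  length (flat_map (arc_words weighted) l) = length l * (if weighted then 3 else 2).
Proof.
  induction l as [|[[u v] c] l IH]; [reflexivity|].
  cbn [flat_map length]. rewrite length_app, IH. destruct weighted; reflexivity.
Qed.

Lemma length_encode_graph weighted G :
  length (encode_graph weighted G) = 2 + nedges G * (if weighted then 3 else 2).
Proof. exact (f_equal (Nat.add 2) (length_flat_map_arc_words weighted (edges G))). Qed.

Lemma nedges_le_length_encode_graph weighted G :
  nedges G + 2 <= length (encode_graph weighted G).
Proof. rewrite length_encode_graph. destruct weighted; lia. Qed.

Definition edge_words (directed weighted : bool) (e : nat * nat) : list nat :=
  flat_map (arc_words weighted) (orientations directed e).

Definition emit_arc (weighted : bool) (a b : expr) : cmd :=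
  emit a;; emit b;; if weighted then emit (Num 1) else Skip.

Definition emit_edge (directed weighted : bool) (a b : expr) : cmd :=
  emit_arc weighted a b;; if directed then emit_arc weighted b a else Skip.

Lemma computes_optional w (b : bool) p m t m' :
  (b = true -> computes w p m t m') -> (b = false -> m = m') -> 0 < t ->
  computes w (if b then p else Skip) m t m'.
Proof.
  intros Hp Hm Ht. destruct b; [auto|]. rewrite <- Hm by reflexivity.
  eapply computes_weaken; [apply computes_skip|exact Ht|reflexivity].
Qed.

Section Emit.

Variables (w : nat) (st : list nat -> state).

Definition tracks_output : Prop := forall L,
  reg (st L) written = length L /\
  forall v, set_reg (set_mem (st L) graph_array (length L) v) written (length L + 1) =
            st (L ++ [v]).

Definition denotes (e : expr) (v : nat) : Prop :=
  forall L, fits w e (st L) /\ value e (st L) = v.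

Hypothesis st_output : tracks_output.

Lemma computes_emit e v L :
  denotes e v -> length (L ++ [v]) < 2 ^ w ->
  computes w (emit e) (st L) (cost e + 6) (st (L ++ [v])).
Proof.
  intros He HL. destruct (He L) as [Hx Hv], (st_output L) as [Hr Hst].
  rewrite length_app in HL. cbn [length] in HL.
  assert (Hr' : reg (set_mem (st L) graph_array (length L) v) written = length L) by exact Hr.
  eapply computes_weaken.
  - eapply computes_seq; [apply computes_put; [exact I|exact Hx]|].
    cbn [value]. rewrite Hr, Hv. apply computes_assign.
    cbn [fits op_fits value op_value]. rewrite Hr'. lia.
  - cbn [cost]. lia.
  - cbn [value op_value]. rewrite Hr'. apply Hst.
Qed.

Lemma computes_emit_arc weighted a b u v L :
  denotes a u -> denotes b v -> 1 < 2 ^ w ->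
  length (L ++ arc_words weighted (u, v, 1)) < 2 ^ w ->
  computes w (emit_arc weighted a b) (st L) (cost a + cost b + 19)
    (st (L ++ arc_words weighted (u, v, 1))).
Proof.
  intros Ha Hb Hw HL. rewrite length_app in HL. unfold emit_arc, arc_words in *.
  eapply computes_weaken.
  - eapply computes_seq; [apply computes_emit; [exact Ha|]|].
    { rewrite length_app. destruct weighted; cbn [length] in *; lia. }
    eapply computes_seq; [apply computes_emit; [exact Hb|]|].
    { rewrite !length_app. destruct weighted; cbn [length] in *; lia. }
    apply computes_optional with (t := 7) (m' := st (L ++ arc_words weighted (u, v, 1)));
      [| |lia]; intros ->; cbn [arc_words]; rewrite <- !app_assoc.
    + change (L ++ [u] ++ [v]) with (L ++ [u; v]).
      replace (L ++ [u; v; 1]) with ((L ++ [u; v]) ++ [1]) by now rewrite <- app_assoc.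
      apply (computes_emit (Num 1)); [intros L'; split; [exact Hw|reflexivity]|].
      rewrite !length_app. cbn [length] in *. lia.
    + reflexivity.
  - lia.
  - reflexivity.
Qed.

Lemma computes_emit_edge directed weighted a b u v L :
  denotes a u -> denotes b v -> 1 < 2 ^ w ->
  length (L ++ edge_words directed weighted (u, v)) < 2 ^ w ->
  computes w (emit_edge directed weighted a b) (st L) (2 * (cost a + cost b + 19))
    (st (L ++ edge_words directed weighted (u, v))).
Proof.
  intros Ha Hb Hw HL. unfold emit_edge, edge_words, orientations in *.
  cbn [flat_map fst snd] in *. rewrite app_assoc in *.
  eapply computes_weaken; [eapply computes_seq| |reflexivity].
  - apply computes_emit_arc; eauto. rewrite !length_app in *. lia.
  - apply computes_optional with (t := cost b + cost a + 19); [| |lia]; intros ->;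
      cbn [flat_map] in *; rewrite app_nil_r in *; [now apply computes_emit_arc|reflexivity].
  - lia.
Qed.

End Emit.

Lemma computes_for_append w x e p t k (st : nat -> list nat -> state) (f : nat -> list nat) L :
  0 < w -> k < 2 ^ w -> (forall i L, reg (st i L) x = 0) ->
  (forall i L, i <= k ->
     fits w e (set_reg (st i L) x i) /\ value e (set_reg (st i L) x i) = k) ->
  (forall i L, i < k -> length (L ++ f i) < 2 ^ w ->
     computes w p (set_reg (st i L) x i) t (set_reg (st (S i) (L ++ f i)) x i)) ->
  length (L ++ flat_map f (seq 0 k)) < 2 ^ w ->
  computes w (For x e p) (st 0 L) (k * (t + cost e + 7) + cost e + 5)
    (st k (L ++ flat_map f (seq 0 k))).
Proof.
  intros Hw Hk Hx He Hp HL.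
  assert (Hmono : forall i, i <= k ->
            length (flat_map f (seq 0 i)) <= length (flat_map f (seq 0 k))).
  { intros i Hi. replace k with (i + (k - i)) by lia.
    rewrite seq_app, flat_map_app, length_app. lia. }
  replace (st 0 L) with (st 0 (L ++ flat_map f (seq 0 0))) by (cbn; now rewrite app_nil_r).
  apply (computes_for w x e p t k (fun i => st i (L ++ flat_map f (seq 0 i)))); auto.
  intros i Hi. specialize (Hmono (S i) Hi).
  rewrite seq_S, flat_map_app in *. cbn [flat_map Nat.add] in *. rewrite app_nil_r in *.
  rewrite app_assoc. apply Hp; [exact Hi|]. rewrite <- app_assoc.
  rewrite !length_app in *. lia.
Qed.

(** * The reduction as a program *)

Definition half (n : nat) : nat := (n + 1) / 2.

Lemma half_spec n : n <= 2 * half n <= n + 1.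
Proof.
  unfold half. pose proof (Nat.div_mod_eq (n + 1) 2).
  pose proof (Nat.mod_upper_bound (n + 1) 2). lia.
Qed.

Definition literal_word : expr := Get input_array ($clause_pos + Num 1 + $literal_index).

Definition literal_test : expr :=
  let x := (literal_word / Num 2)%expr in
  (x / $half_vars =? $vertex / $half_size) *
  (Bin Shr ($vertex) (x mod $half_vars) mod Num 2 =? literal_word mod Num 2).

Definition num_vectors : expr := $half_size + $half_size.
Definition hub_vertex (i : expr) : expr := num_vectors + $num_clauses + i.

Section Program.

Variables directed weighted : bool.

Definition link (a b : expr) : cmd := emit_edge directed weighted a b.

Definition scan_clause : cmd :=
  Search literal_index (Get input_array ($clause_pos)) literal_test clause_holds;;
  Cond ($clause_holds) Skip (link ($vertex) (num_vectors + $clause_index));;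
  clause_holds ::= Num 0;;
  clause_pos ::= $clause_pos + Num 1 + Get input_array ($clause_pos).

Definition link_vector : cmd :=
  For clause_index ($num_clauses) scan_clause;;
  clause_pos ::= Num 2;;
  link ($vertex) (hub_vertex ($vertex / $half_size)).

Definition link_vertex : cmd :=
  Cond ($vertex <? num_vectors)
    link_vector
    (Cond ($vertex <? num_vectors + $num_clauses)
      (link ($vertex) (hub_vertex (Num 0)))
      Skip;;
     link ($vertex) (hub_vertex (Num 1))).

(* The two zeros are overwritten by the numbers of vertices and edges at the end. *)
Definition setup : cmd :=
  num_clauses ::= Get input_array (Num 1);;
  half_vars ::= (Get input_array (Num 0) + Num 1) / Num 2;;
  half_size ::= Bin Shl (Num 1) ($half_vars);;
  clause_pos ::= Num 2;;
  emit (Num 0);;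
  emit (Num 0).

Definition build : cmd :=
  setup;;
  For vertex (hub_vertex (Num 1)) link_vertex;;
  Put graph_array (Num 0) (hub_vertex (Num 2));;
  Put graph_array (Num 1) (($written - Num 2) / Num (if weighted then 3 else 2)).

Definition decide : cmd :=
  Search vertex ($half_size) (Get ecc_array ($vertex) =? Num 4) answer;;
  Put output_array (Num 0) ($answer).

End Program.

Definition encode_clause (C : clause) : list nat := length C :: map encode_literal C.

Section Build.

Variables (directed weighted : bool) (w k n h : nat) (Cs : list clause).

Local Notation N := (2 ^ h).
Local Notation M := (length Cs).
Local Notation input := (encode_cnf (Cnf n Cs)).
Local Notation R := (falsified_clause h Cs).
Local Notation G := (ov_graph N M R directed).
Local Notation clause_at j := (nth j Cs []).
Local Notation words := (edge_words directed weighted).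

Hypothesis wide :
  2 * n + length input + nverts G + length (encode_graph weighted G) < 2 ^ w.
Hypothesis short_clauses : forall C, In C Cs -> length C <= k.

Definition offset (j : nat) : nat := 2 + length (flat_map encode_clause (firstn j Cs)).

Definition build_store (u j pos : nat) (holds : bool) (L : list nat) : state :=
  listed [M; h; N; u; j; 0; pos; Nat.b2n holds; length L] (layout input L).

Lemma build_store_tracks_output u j pos holds :
  tracks_output (build_store u j pos holds).
Proof.
  intros L. split; [reflexivity|]. intros v. unfold build_store at 2.
  rewrite <- set_nth_length, <- layout_set_nth, set_nth_length, length_app.
  exact (set_reg_listed _ _ _ _).
Qed.

Lemma build_store_set_word u j pos holds L i v :
  i < length L ->
  set_mem (build_store u j pos holds L) graph_array i v =
  build_store u j pos holds (set_nth i v L).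
Proof.
  intros Hi. unfold build_store. rewrite length_set_nth by exact Hi.
  rewrite <- layout_set_nth. reflexivity.
Qed.

Lemma input_word j i :
  j < M -> i <= length (clause_at j) ->
  nth (offset j + i) input 0 = nth i (encode_clause (clause_at j)) 0.
Proof.
  intros Hj Hi. cbn. apply (nth_flat_map encode_clause); [exact Hj|].
  cbn. rewrite length_map. lia.
Qed.

Lemma input_literal j i l :
  j < M -> i < length (clause_at j) ->
  nth (offset j + 1 + i) input 0 = encode_literal (nth i (clause_at j) l).
Proof.
  intros Hj Hi. rewrite <- Nat.add_assoc, input_word by lia. unfold encode_clause.
  cbn [nth Nat.add]. rewrite nth_indep with (d' := encode_literal l)
    by (rewrite length_map; lia). apply map_nth.
Qed.

Lemma offset_S j : j < M -> offset (S j) = offset j + 1 + length (clause_at j).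
Proof.
  intros Hj. unfold offset. rewrite (length_flat_map_firstn_S encode_clause Cs j [] Hj).
  unfold encode_clause. cbn [length]. rewrite length_map. lia.
Qed.

Lemma offset_le j : offset j <= length input.
Proof. apply le_n_S, le_n_S, (length_flat_map_firstn_le encode_clause). Qed.

Lemma word_size_bounds : 0 < w /\ 5 < 2 ^ w /\ 2 * N + M + 2 < 2 ^ w.
Proof.
  pose proof (pow2_pos h). pose proof wide as Hw.
  cbn [nverts ov_graph unit_graph encode_cnf encode_graph length] in Hw.
  split; [|lia]. destruct (Nat.eq_0_gt_0_cases w) as [E|Hpos]; [|exact Hpos].
  rewrite E in Hw. cbn [Nat.pow] in Hw. lia.
Qed.

Ltac store_simpl :=
  unfold build_store; rewrite ?set_reg_listed;
  cbn [set_nth hd tl fits op_fits value op_value reg mem listed nth layout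
       num_vectors hub_vertex literal_word literal_test input_array].

Ltac store_solve := store_simpl; repeat split; try lia.

Lemma encode_literal_test u l :
  let x := encode_literal l in
  Nat.b2n (x / 2 / h =? u / N) *
    Nat.b2n (Nat.shiftr u ((x / 2) mod h) mod 2 =? x mod 2) =
  Nat.b2n (lit_true h u l).
Proof.
  destruct l as [v b]. unfold encode_literal, lit_true. cbn [fst snd].
  assert (Hb : Nat.b2n b < 2) by (destruct b; cbn; lia).
  rewrite <- (Nat.div_unique _ 2 v _ Hb eq_refl), <- (Nat.mod_unique _ 2 v _ Hb eq_refl).
  rewrite Nat.shiftr_div_pow2, <- Nat.testbit_spec'.
  destruct (v / h =? u / N), (Nat.testbit u (v mod h)), b; reflexivity.
Qed.

Lemma computes_search_literal u j L :
  j < M ->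
  computes w (Search literal_index (Get input_array ($clause_pos)) literal_test clause_holds)
    (build_store u j (offset j) false L) (100 * k + 10)
    (build_store u j (offset j) (existsb (lit_true h u) (clause_at j)) L).
Proof.
  intros Hj. destruct word_size_bounds as (Hw & Hsmall & _).
  pose proof (offset_le (S j)) as Hoff. rewrite (offset_S j Hj) in Hoff.
  assert (HC : length (clause_at j) <= k) by (apply short_clauses, nth_In; exact Hj).
  rewrite <- (existsb_seq_nth (lit_true h u) (clause_at j) (0, false)).
  eapply computes_weaken; [apply computes_search with (k := length (clause_at j))
    (P := fun i => lit_true h u (nth i (clause_at j) (0, false)))| |]; auto; try lia.
  - intros i b Hi. store_solve.
    rewrite <- (Nat.add_0_r (offset j)), input_word by lia. reflexivity.
  - intros i b Hi. store_solve;
      rewrite (input_literal j i (0, false)), encode_literal_test by auto;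
      auto using b2n_lt_pow2.
  - cbn [cost literal_test literal_word]. nia.
  - unfold build_store. now rewrite set_reg_listed.
Qed.

Lemma denotes_vertex u j pos holds : denotes w (build_store u j pos holds) ($vertex) u.
Proof. intros L. split; [exact I|reflexivity]. Qed.

Lemma computes_link b u v j pos holds L :
  cost b <= 20 -> denotes w (build_store u j pos holds) b v ->
  length (L ++ words (u, v)) < 2 ^ w ->
  computes w (link directed weighted ($vertex) b) (build_store u j pos holds L) 80
    (build_store u j pos holds (L ++ words (u, v))).
Proof.
  intros Hc Hb HL. destruct word_size_bounds as (_ & Hsmall & _).
  eapply computes_weaken; [apply computes_emit_edge| |reflexivity].
  - apply build_store_tracks_output.
  - apply denotes_vertex.
  - exact Hb.
  - lia.
  - exact HL.
  - cbn [cost]. lia.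
Qed.

Definition conflict_words (u j : nat) : list nat :=
  if R u j then words (u, coordinate N j) else [].

Lemma computes_scan_clause u j L :
  u < 2 * N -> j < M -> length (L ++ conflict_words u j) < 2 ^ w ->
  computes w (scan_clause directed weighted)
    (build_store u j (offset j) false L) (100 * k + 150)
    (build_store u j (offset (S j)) false (L ++ conflict_words u j)).
Proof.
  intros Hu Hj HL. destruct word_size_bounds as (Hw & Hsmall & Hv).
  pose proof (offset_le (S j)) as Hoff. rewrite (offset_S j Hj) in *.
  assert (Hlen : nth (offset j) input 0 = length (clause_at j)).
  { rewrite <- (Nat.add_0_r (offset j)), input_word by lia. reflexivity. }
  set (holds := existsb (lit_true h u) (clause_at j)).
  assert (HR : R u j = negb holds) by reflexivity.
  eapply computes_weaken.
  - eapply computes_seq; [now apply computes_search_literal|]. fold holds.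
    eapply computes_seq with
      (m1 := build_store u j (offset j) holds (L ++ conflict_words u j)).
    { apply computes_cond with (t := 80); [exact I| |]; unfold conflict_words in *;
        rewrite HR in *; destruct holds; cbn [negb]; intros H; try easy.
      - rewrite app_nil_r. eapply computes_weaken; [apply computes_skip|lia|reflexivity].
      - apply computes_link; [cbn; lia| |exact HL].
        intros L'. unfold coordinate. store_solve. }
    eapply computes_seq; [apply computes_assign; store_solve|].
    apply computes_assign. store_simpl. rewrite Hlen. repeat split; lia.
  - cbn [cost]. lia.
  - store_simpl. now rewrite Hlen.
Qed.

Lemma set_clause_index u j j' pos holds L :
  set_reg (build_store u j pos holds L) clause_index j' = build_store u j' pos holds L.
Proof. apply set_reg_listed. Qed.

Lemma set_vertex u u' j pos holds L :
  set_reg (build_store u j pos holds L) vertex u' = build_store u' j pos holds L.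
Proof. apply set_reg_listed. Qed.

Definition vertex_words (u : nat) : list nat :=
  flat_map words (map (pair u) (upper_neighbours N M R u)).

Lemma vertex_words_vector u :
  u < 2 * N ->
  vertex_words u = flat_map (conflict_words u) (seq 0 M) ++ words (u, hub N M (u / N)).
Proof.
  intros Hu. unfold vertex_words, upper_neighbours. rewrite (proj2 (Nat.ltb_lt _ _) Hu).
  rewrite flat_map_map, flat_map_app, flat_map_map, flat_map_filter.
  cbn [flat_map]. now rewrite app_nil_r.
Qed.

Lemma computes_link_vector u L :
  u < 2 * N -> length (L ++ vertex_words u) < 2 ^ w ->
  computes w (link_vector directed weighted) (build_store u 0 2 false L)
    (M * (100 * k + 160) + 100) (build_store u 0 2 false (L ++ vertex_words u)).
Proof.
  intros Hu HL. rewrite vertex_words_vector, app_assoc in * by exact Hu.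
  destruct word_size_bounds as (Hw & Hsmall & Hv).
  assert (Hside : u / N <= 1) by (destruct (half_cases N u Hu) as [[-> _]|[-> _]]; lia).
  eapply computes_weaken; [eapply computes_seq; [|eapply computes_seq]| |reflexivity].
  - apply (computes_for_append w _ _ _ (100 * k + 150) M
      (fun j => build_store u 0 (offset j) false) (conflict_words u)); auto; [lia| | |].
    + intros j L' Hj. rewrite set_clause_index. now split.
    + intros j L' Hj HL'. rewrite !set_clause_index. now apply computes_scan_clause.
    + rewrite length_app in HL. lia.
  - apply computes_assign. store_solve.
  - cbn [value]. replace (set_reg _ clause_pos 2) with
      (build_store u 0 2 false (L ++ flat_map (conflict_words u) (seq 0 M)))
      by (symmetry; apply set_reg_listed).
    apply computes_link; [cbn; lia| |exact HL].
    intros L'. unfold hub. store_solve.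
  - cbn [cost]. lia.
Qed.

Lemma vertex_words_other u :
  2 * N <= u ->
  vertex_words u =
  (if u <? 2 * N + M then words (u, hub N M 0) else []) ++ words (u, hub N M 1).
Proof.
  intros Hu. unfold vertex_words, upper_neighbours. rewrite (proj2 (Nat.ltb_ge _ _) Hu).
  destruct (u <? 2 * N + M); cbn [map flat_map]; now rewrite app_nil_r.
Qed.

Lemma computes_link_vertex u L :
  u < 2 * N + M + 1 -> length (L ++ vertex_words u) < 2 ^ w ->
  computes w (link_vertex directed weighted) (build_store u 0 2 false L)
    (M * (100 * k + 160) + 200) (build_store u 0 2 false (L ++ vertex_words u)).
Proof.
  intros Hu HL. destruct word_size_bounds as (Hw & Hsmall & Hv).
  assert (Hhub : forall i, i < 2 ->
            denotes w (build_store u 0 2 false) (hub_vertex (Num i)) (hub N M i))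
    by (intros i Hi L'; unfold hub; store_solve).
  assert (Hvector : value ($vertex <? num_vectors) (build_store u 0 2 false L) =
            Nat.b2n (u <? 2 * N)) by (store_simpl; do 2 f_equal; lia).
  assert (Hcoord : value ($vertex <? num_vectors + $num_clauses) (build_store u 0 2 false L) =
            Nat.b2n (u <? 2 * N + M)) by (store_simpl; do 2 f_equal; lia).
  eapply computes_weaken;
    [apply computes_cond with (t := M * (100 * k + 160) + 190)| |reflexivity].
  - store_solve.
  - rewrite Hvector. destruct (Nat.ltb_spec u (2 * N)) as [Hlt|Hge]; [|easy]. intros _.
    eapply computes_weaken; [now apply computes_link_vector|lia|reflexivity].
  - rewrite Hvector. destruct (Nat.ltb_spec u (2 * N)) as [Hlt|Hge]; [easy|]. intros _.
    rewrite vertex_words_other, app_assoc in * by exact Hge.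
    eapply computes_weaken; [eapply computes_seq with (m1 := build_store u 0 2 false
      (L ++ if u <? 2 * N + M then words (u, hub N M 0) else []))| |reflexivity].
    + apply computes_cond with (t := 80); [store_solve| |]; rewrite Hcoord;
        destruct (u <? 2 * N + M); cbn [Nat.b2n]; intros Hc; try easy.
      * apply computes_link; [cbn; lia|apply Hhub; lia|].
        rewrite length_app in HL. lia.
      * rewrite app_nil_r. eapply computes_weaken; [apply computes_skip|lia|reflexivity].
    + apply computes_link; [cbn; lia|apply Hhub; lia|exact HL].
    + cbn [cost num_vectors]. lia.
  - cbn [cost num_vectors]. lia.
Qed.

Lemma computes_setup :
  h = half n ->
  computes w setup (listed [] (layout input [])) 50 (build_store 0 0 2 false [0; 0]).
Proof.
  intros Hh. unfold half in Hh. destruct word_size_bounds as (Hw & Hsmall & Hv).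
  pose proof (build_store_tracks_output 0 0 2 false) as Hout.
  assert (Hzero : denotes w (build_store 0 0 2 false) (Num 0) 0)
    by (intros L; split; [cbn; lia|reflexivity]).
  pose proof wide as Hwide. cbn [encode_cnf length] in Hwide.
  eapply computes_weaken;
    [eapply computes_seq; [|eapply computes_seq; [|eapply computes_seq;
      [|eapply computes_seq; [|eapply computes_seq]]]]| |reflexivity].
  - apply computes_assign. store_solve.
  - apply computes_assign. store_simpl. cbn [encode_cnf nth nvars]. lia.
  - apply computes_assign. store_simpl. cbn [encode_cnf nth nvars].
    rewrite <- Hh, Nat.shiftl_1_l. lia.
  - apply computes_assign. store_solve.
  - match goal with |- computes _ _ ?m _ _ =>
      replace m with (build_store 0 0 2 false []) end.
    + apply (computes_emit w (build_store 0 0 2 false) Hout (Num 0) 0 []); [exact Hzero|].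
      cbn. lia.
    + store_simpl. cbn [encode_cnf nth nvars clauses Nat.b2n length].
      rewrite <- Hh, Nat.shiftl_1_l. apply state_ext; [|reflexivity].
      intros x. do 9 (destruct x as [|x]; [reflexivity|]). now destruct x.
  - apply (computes_emit w (build_store 0 0 2 false) Hout (Num 0) 0 [0]); [exact Hzero|].
    cbn. lia.
  - cbn. lia.
Qed.

Lemma flat_map_vertex_words :
  flat_map vertex_words (seq 0 (2 * N + M + 1)) = flat_map (arc_words weighted) (edges G).
Proof.
  cbn [edges ov_graph unit_graph]. unfold vertex_words, edge_words, ov_edges, adjacency_pairs.
  now rewrite !flat_map_flat_map.
Qed.

Lemma computes_build :
  h = half n ->
  computes w (build directed weighted) (listed [] (layout input []))
    ((2 * N + M + 1) * (M * (100 * k + 160) + 250) + 150)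
    (build_store 0 0 2 false (encode_graph weighted G)).
Proof.
  intros Hh. destruct word_size_bounds as (Hw & Hsmall & Hv).
  set (L := flat_map vertex_words (seq 0 (2 * N + M + 1))).
  assert (HG : encode_graph weighted G = 2 * N + M + 2 :: nedges G :: L)
    by (unfold L; now rewrite flat_map_vertex_words).
  assert (HL : length L = nedges G * (if weighted then 3 else 2)).
  { unfold L. rewrite flat_map_vertex_words. apply length_flat_map_arc_words. }
  assert (Hlen : 2 + length L < 2 ^ w).
  { pose proof wide as Hwide. rewrite HG in Hwide. cbn [length] in Hwide. lia. }
  rewrite HG. eapply computes_weaken;
    [eapply computes_seq; [|eapply computes_seq; [|eapply computes_seq with
      (m1 := build_store 0 0 2 false (2 * N + M + 2 :: 0 :: L))]]| |reflexivity].
  - now apply computes_setup.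
  - apply (computes_for_append w _ _ _ (M * (100 * k + 160) + 200) (2 * N + M + 1)
      (fun _ => build_store 0 0 2 false) vertex_words [0; 0]); auto; [lia| |].
    + intros i L' Hi. rewrite set_vertex. store_solve.
    + intros i L' Hi HL'. rewrite !set_vertex. now apply computes_link_vertex.
  - fold L. eapply computes_weaken; [apply computes_put; store_solve|reflexivity|].
    cbn [value]. rewrite build_store_set_word by (cbn; lia). store_simpl.
    do 3 f_equal. lia.
  - eapply computes_weaken; [apply computes_put; [cbn; lia|]|reflexivity|].
    + store_simpl. cbn [length]. destruct weighted; lia.
    + cbn [value]. rewrite build_store_set_word by (cbn; lia). store_simpl. cbn [length].
      rewrite HL. replace (S (S _) - 2) with (nedges G * (if weighted then 3 else 2)) by lia.
      now rewrite Nat.div_mul by now destruct weighted.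
  - cbn [cost num_vectors hub_vertex]. lia.
Qed.

End Build.

Lemma computes_decide w m N :
  4 < 2 ^ w -> N < 2 ^ w ->
  reg m half_size = N -> reg m vertex = 0 -> reg m answer = 0 ->
  let found := Nat.b2n (existsb (fun u => mem m ecc_array u =? 4) (seq 0 N)) in
  computes w decide m (30 * N + 20) (set_mem (set_reg m answer found) output_array 0 found).
Proof.
  intros Hfour HN Hsize Hvertex Hanswer found.
  assert (Hw : 0 < w) by (destruct w; cbn in Hfour; lia).
  eapply computes_weaken; [eapply computes_seq| |].
  - apply computes_search with (k := N) (P := fun u => mem m ecc_array u =? 4); auto.
    + intros i b Hi. now split.
    + intros i b Hi. cbn [fits op_fits]. now repeat split.
  - apply computes_put; cbn [fits]; [lia|exact I].
  - cbn [cost]. lia.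
  - cbn [value set_reg reg]. now rewrite upd_same.
Qed.

Definition reduction (directed weighted : bool) (p : cmd) : cmd :=
  build directed weighted;; rename sub_reg (fun a => S (S a)) p;; decide.

Definition sat_graph (directed : bool) (F : cnf) : graph :=
  ov_graph (2 ^ half (nvars F)) (length (clauses F))
    (falsified_clause (half (nvars F)) (clauses F)) directed.

Lemma nverts_sat_graph directed F :
  nverts (sat_graph directed F) = 2 * 2 ^ half (nvars F) + length (clauses F) + 2.
Proof. reflexivity. Qed.

Lemma nedges_sat_graph directed F :
  2 * 2 ^ half (nvars F) + length (clauses F) + 1 <= nedges (sat_graph directed F) <=
  2 * (2 * 2 ^ half (nvars F) + length (clauses F) + 1) * (length (clauses F) + 1).
Proof. apply nedges_ov_graph. Qed.

Lemma max_weight_sat_graph directed F : max_weight (sat_graph directed F) <= 1.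
Proof. apply max_weight_ov_graph. Qed.

Lemma is_graph_sat_graph directed weighted F :
  is_graph directed weighted (sat_graph directed F).
Proof. apply is_graph_ov_graph. Qed.

Definition instance_size (directed weighted : bool) (F : cnf) : nat :=
  2 * nvars F + length (encode_cnf F) + nverts (sat_graph directed F) +
  length (encode_graph weighted (sat_graph directed F)).

Definition lists_eccentricities (directed : bool) (G : graph) (out : nat -> nat) : Prop :=
  forall x, x < nverts G -> exists e, is_ecc directed G x e /\ out x = encode_ext e.

Lemma satisfiable_iff_ecc_three directed F out :
  (forall C, In C (clauses F) -> forall l, In l C -> fst l < nvars F) ->
  lists_eccentricities directed (sat_graph directed F) out ->
  (satisfiable F <-> existsb (fun u => out u =? 4) (seq 0 (2 ^ half (nvars F))) = true).
Proof.
  intros Hvar Hout. pose proof (half_spec (nvars F)) as Hh.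
  rewrite existsb_exists, (satisfiable_iff_orthogonal F (half (nvars F)))
    by (intros C HC l Hl; specialize (Hvar C HC l Hl); lia).
  assert (Hfour : forall u, u < 2 ^ half (nvars F) -> (out u =? 4) = true <-> exists v,
            2 ^ half (nvars F) <= v < 2 * 2 ^ half (nvars F) /\
            orthogonal (length (clauses F))
              (falsified_clause (half (nvars F)) (clauses F)) u v).
  { intros u Hu. destruct (Hout u) as (e & He & Ho); [rewrite nverts_sat_graph; lia|].
    rewrite Nat.eqb_eq, Ho, <- (ecc_three_iff _ _ _ directed u Hu e He).
    destruct e as [d|]; cbn [encode_ext]; split; intros H; congruence. }
  split.
  - intros (u & v & Hu & Hv). exists u. split; [apply in_seq; lia|].
    apply Hfour; eauto.
  - intros (u & Hs & H). apply in_seq in Hs. apply Hfour in H as (v & Hv); [|lia].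
    exists u, v. split; [lia|exact Hv].
Qed.

Lemma in_encode_cnf_le k F x :
  is_kcnf k F -> In x (encode_cnf F) -> x <= 2 * nvars F + length (clauses F) + k.
Proof.
  intros [_ HF] [<-|[<-|Hx]]; [lia|lia|].
  apply in_flat_map in Hx as (C & HC & Hx). destruct (HF C HC) as [Hk Hvar].
  destruct Hx as [<-|Hx]; [lia|]. apply in_map_iff in Hx as (l & <- & Hl).
  specialize (Hvar l Hl). unfold encode_literal. destruct (snd l); cbn [Nat.b2n]; lia.
Qed.

Lemma in_encode_graph_le directed weighted G x :
  is_graph directed weighted G -> In x (encode_graph weighted G) ->
  x <= nverts G + max_weight G + nedges G.
Proof.
  intros (_ & HG & _) [<-|[<-|Hx]]; [lia|lia|].
  apply in_flat_map in Hx as ([[u v] c] & He & Hx).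
  destruct (HG u v c He) as (Hu & Hv & _).
  assert (Hc : c <= max_weight G).
  { apply (proj1 (Forall_forall _ _) (proj1 (list_max_le _ _) (le_n _))).
    apply in_map_iff. now exists (u, v, c). }
  destruct weighted; cbn [In] in Hx; intuition (subst; lia).
Qed.

Section Reduction.

Variables (directed weighted : bool) (k w : nat) (F : cnf).

Local Notation N := (2 ^ half (nvars F)).
Local Notation M := (length (clauses F)).
Local Notation G := (sat_graph directed F).

Hypothesis F_kcnf : is_kcnf k F.
Hypothesis wide : instance_size directed weighted F + k < 2 ^ w.

Lemma encode_cnf_fits x : In x (encode_cnf F) -> x < 2 ^ w.
Proof.
  intros Hx. pose proof (in_encode_cnf_le k F x F_kcnf Hx). pose proof wide as Hw.
  unfold instance_size in Hw. rewrite nverts_sat_graph in Hw. lia.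
Qed.

Lemma encode_sat_graph_fits x : In x (encode_graph weighted G) -> x < 2 ^ w.
Proof.
  intros Hx. pose proof wide as Hw. unfold instance_size in Hw.
  cbn [encode_cnf length] in Hw. pose proof (nedges_le_length_encode_graph weighted G).
  pose proof (in_encode_graph_le directed weighted G x (is_graph_sat_graph _ _ _) Hx).
  pose proof (max_weight_sat_graph directed F). lia.
Qed.

Definition reduction_time : nat :=
  (2 * N + M + 1) * (M * (100 * k + 160) + 250) + 30 * N + 170.

Lemma runs_reduction p T :
  runs w p (encode_graph weighted G) T (lists_eccentricities directed G) ->
  runs w (reduction directed weighted p) (encode_cnf F) (INR reduction_time + T)
    (fun out => (satisfiable F /\ out 0 = 1) \/ (~ satisfiable F /\ out 0 = 0)).
Proof.
  intros (t2 & s2 & Hexec2 & Htime2 & Hout).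
  assert (Hrep0 : represents w (init w (encode_cnf F)) (listed [] (layout (encode_cnf F) []))).
  { rewrite <- (init_listed w) by exact encode_cnf_fits.
    split; [apply bounded_init|now split]. }
  destruct (computes_build directed weighted w k (nvars F) (half (nvars F)) (clauses F)
    (Nat.le_lt_trans _ _ _ (Nat.le_add_r _ k) wide)
    (fun C HC => proj1 (proj2 F_kcnf C HC)) eq_refl _ Hrep0)
      as (t1 & s1 & Hexec1 & Htime1 & Hrep1 & Hframe1).
  fold (sat_graph directed F) in Hrep1.
  destruct (exec_call w p (encode_graph weighted G) _ s1 t2 s2 Hrep1)
    as (s1' & Hexec1' & Hrep1').
  { intros x. now rewrite Hframe1. }
  { intros [|a]; [|reflexivity]. extensionality i. symmetry.
    exact (trunc_nth w _ i encode_sat_graph_fits). }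
  { exact Hexec2. }
  set (m := State _ _) in Hrep1'.
  assert (4 < 2 ^ w /\ N < 2 ^ w) as [Hfour HN].
  { pose proof wide as Hw. pose proof (pow2_pos (half (nvars F))). unfold instance_size in Hw.
    rewrite nverts_sat_graph in Hw. cbn [encode_cnf length] in Hw. lia. }
  destruct (computes_decide w m N Hfour HN eq_refl eq_refl eq_refl s1' Hrep1')
    as (t3 & s3 & Hexec3 & Htime3 & (_ & _ & Hmem3) & _).
  exists (t1 + (t2 + t3)), s3. split; [repeat econstructor; eassumption|]. split.
  - enough (INR t1 + INR t3 <= INR reduction_time)%R by (rewrite !plus_INR; lra).
    rewrite <- plus_INR. apply le_INR. unfold reduction_time. lia.
  - rewrite Hmem3. cbn [mem set_mem set_reg]. rewrite !upd_same.
    pose proof (satisfiable_iff_ecc_three directed F _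
      (fun C HC => proj2 (proj2 F_kcnf C HC)) Hout) as Hsat.
    change (mem m ecc_array) with (mem s2 output_array).
    destruct (existsb _ _); [left|right]; (split; [|reflexivity]); rewrite Hsat; easy.
Qed.

End Reduction.

(** * Asymptotics *)

Definition blowup (k n : nat) : nat := 64 * (k + 1) * (2 * n + 1) ^ (2 * k).

Lemma blowup_pos k n : 0 < blowup k n.
Proof. unfold blowup. pose proof (Nat.pow_nonzero (2 * n + 1) (2 * k)). lia. Qed.

Lemma succ_double_le_pow2 n : 2 * n + 1 <= 2 ^ (n + 1).
Proof.
  pose proof (Nat.pow_gt_lin_r 2 n ltac:(lia)). rewrite (Nat.add_1_r n), Nat.pow_succ_r'. lia.
Qed.

Lemma blowup_lt_pow2 k n w :
  (3 * k + 7) * (n + 1) <= w -> 2 ^ half n * blowup k n < 2 ^ w.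
Proof.
  intros Hw. pose proof (half_spec n) as Hh.
  assert (HN : 2 ^ half n <= 2 ^ n) by (apply Nat.pow_le_mono_r; lia).
  assert (Hk : k + 1 <= 2 ^ k) by (pose proof (Nat.pow_gt_lin_r 2 k); lia).
  assert (HQ : (2 * n + 1) ^ (2 * k) <= 2 ^ ((n + 1) * (2 * k))).
  { rewrite (Nat.pow_mul_r 2 (n + 1)). apply Nat.pow_le_mono_l, succ_double_le_pow2. }
  apply Nat.le_lt_trans with (2 ^ n * (2 ^ 6 * 2 ^ k * 2 ^ ((n + 1) * (2 * k)))).
  - unfold blowup. apply Nat.mul_le_mono; [exact HN|]. apply Nat.mul_le_mono; [|exact HQ].
    apply (Nat.mul_le_mono_l _ _ 64), Hk.
  - rewrite <- !Nat.pow_add_r. apply Nat.pow_lt_mono_r; lia.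
Qed.

Definition size_range (k n : nat) : list nat :=
  seq (2 ^ half n) (2 ^ half n * blowup k n + 1 - 2 ^ half n).

Lemma in_size_range k n x :
  In x (size_range k n) <-> 2 ^ half n <= x <= 2 ^ half n * blowup k n.
Proof.
  unfold size_range. rewrite in_seq. pose proof (blowup_pos k n).
  assert (2 ^ half n <= 2 ^ half n * blowup k n) by nia. lia.
Qed.

Lemma length_encode_cnf_le k F :
  is_kcnf k F -> length (encode_cnf F) <= 2 + length (clauses F) * (k + 1).
Proof.
  intros [_ HF]. do 2 apply le_n_S.
  apply (length_flat_map_between encode_clause 0). intros C HC. unfold encode_clause.
  cbn [length]. rewrite length_map. pose proof (proj1 (HF C HC)). lia.
Qed.

Section Size.

Variables (k : nat) (F : cnf).
Hypothesis F_kcnf : is_kcnf k F.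

Local Notation N := (2 ^ half (nvars F)).
Local Notation M := (length (clauses F)).
Local Notation B := (N * ((2 * nvars F + 1) ^ k * (2 * nvars F + 1) ^ k)).

Lemma pow2_half_mul_blowup : N * blowup k (nvars F) = 64 * (k + 1) * B.
Proof.
  unfold blowup. replace (2 * k) with (k + k) by lia. rewrite Nat.pow_add_r. lia.
Qed.

Lemma scale_bounds :
  0 < B /\ N <= B /\ M <= B /\ nvars F <= 2 * B /\ (2 * N + M + 1) * (M + 1) <= 8 * B.
Proof.
  pose proof (kcnf_num_clauses k F F_kcnf) as HM. pose proof (half_spec (nvars F)) as Hh.
  pose proof (Nat.pow_gt_lin_r 2 (half (nvars F)) ltac:(lia)) as HN.
  assert (HQ : 1 <= (2 * nvars F + 1) ^ k) by (apply Nat.neq_0_lt_0, Nat.pow_nonzero; lia).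
  assert (HQQ : (2 * nvars F + 1) ^ k <= (2 * nvars F + 1) ^ k * (2 * nvars F + 1) ^ k) by nia.
  assert (HNB : N <= B) by nia.
  assert (HQB : (2 * nvars F + 1) ^ k * (2 * nvars F + 1) ^ k <= B) by nia.
  assert (HMN : N * M <= B) by (apply Nat.mul_le_mono_l; lia).
  assert (HMM : M * M <= B).
  { eapply Nat.le_trans; [apply Nat.mul_le_mono; exact HM|exact HQB]. }
  repeat split; lia.
Qed.

Lemma instance_size_le directed weighted :
  instance_size directed weighted F + k <= N * blowup k (nvars F).
Proof.
  rewrite pow2_half_mul_blowup. destruct scale_bounds as (HB & HN & HM & Hn & HMN).
  pose proof (length_encode_cnf_le k F F_kcnf) as Hinput.
  destruct (nedges_sat_graph directed F) as [_ Hedges].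
  assert (Hencoding : length (encode_graph weighted (sat_graph directed F)) <=
            2 + 3 * nedges (sat_graph directed F))
    by (rewrite length_encode_graph; destruct weighted; lia).
  unfold instance_size. rewrite nverts_sat_graph.
  assert (HMk : M * k <= B * k) by now apply Nat.mul_le_mono_r.
  assert (Hk : 1 * k <= B * k) by now apply Nat.mul_le_mono_r.
  lia.
Qed.

Lemma reduction_time_le : reduction_time k F <= 40 * (N * blowup k (nvars F)).
Proof.
  rewrite pow2_half_mul_blowup. destruct scale_bounds as (HB & HN & HM & Hn & HMN).
  unfold reduction_time.
  pose proof (Nat.mul_le_mono_r _ _ (100 * k + 250) HMN) as Htime. lia.
Qed.

Variables directed weighted : bool.

Local Notation G := (sat_graph directed F).

Lemma sat_graph_sizes_in_range :
  In (nedges G) (size_range k (nvars F)) /\ In (nverts G) (size_range k (nvars F)).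
Proof.
  pose proof (instance_size_le directed weighted) as Hsize. unfold instance_size in Hsize.
  pose proof (nedges_le_length_encode_graph weighted G).
  pose proof (nedges_sat_graph directed F). pose proof (nverts_sat_graph directed F).
  rewrite !in_size_range. lia.
Qed.

Lemma log2_sat_graph_le :
  Nat.log2 (nverts G + max_weight G + 2) <= (3 * k + 7) * (nvars F + 1).
Proof.
  apply Nat.lt_le_incl, Nat.log2_lt_pow2; [lia|].
  eapply Nat.le_lt_trans; [|now apply blowup_lt_pow2].
  pose proof (instance_size_le directed weighted) as Hsize. unfold instance_size in Hsize.
  pose proof (nedges_le_length_encode_graph weighted G).
  pose proof (max_weight_sat_graph directed F). cbn [encode_cnf length] in Hsize. lia.
Qed.

End Size.


Local Open Scope R_scope.

(* The bound on [g] only holds for large arguments, hence the maximum over all the sizes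
   that the reduction can produce. *)
Definition sat_time (g : nat -> nat -> R) (k n : nat) : R :=
  40 * INR (2 ^ half n * blowup k n) +
  MaxRlist (map (fun '(m, v) => g m v) (list_prod (size_range k n) (size_range k n))).

Lemma kSAT_of_eccentricities directed weighted g k :
  Eccentricities_in_time directed weighted g -> kSAT_in_time k (sat_time g k).
Proof.
  intros (p & c & Hp).
  exists (reduction directed weighted p), ((c + 1) * (3 * k + 7))%nat.
  intros F HF w Hw.
  assert (Hlog : (c * Nat.log2 (nverts (sat_graph directed F) +
                    max_weight (sat_graph directed F) + 2) <= w)%nat)
    by (pose proof (log2_sat_graph_le k F HF directed weighted); nia).
  assert (Hwide : (instance_size directed weighted F + k < 2 ^ w)%nat).
  { eapply Nat.le_lt_trans; [now apply instance_size_le|]. apply blowup_lt_pow2. nia. }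
  destruct (runs_reduction directed weighted k w F HF Hwide p _
    (Hp _ (is_graph_sat_graph directed weighted F) w Hlog)) as (t & s & Hexec & Ht & Hpost).
  exists t, s. split; [exact Hexec|]. split; [|exact Hpost].
  eapply Rle_trans; [exact Ht|]. apply Rplus_le_compat.
  - change 40 with (IZR (Z.of_nat 40)).
    rewrite <- INR_IZR_INZ, <- mult_INR. now apply le_INR, reduction_time_le.
  - destruct (sat_graph_sizes_in_range k F HF directed weighted) as [Hm Hv].
    apply MaxRlist_P1, in_map_iff. eexists (_, _).
    split; [reflexivity|apply in_prod; [exact Hm|exact Hv]].
Qed.

Lemma exp_le (x y : R) : x <= y -> exp x <= exp y.
Proof. intros [H| ->]; [apply Rlt_le, exp_increasing, H|apply Rle_refl]. Qed.

Lemma Rpower_between (a N P x : R) :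
  0 < N -> 1 <= P -> N <= x <= N * P -> Rpower x a <= Rpower N a * Rpower P (Rabs a).
Proof.
  intros HN HP Hx. destruct (Rle_or_lt 0 a) as [Ha|Ha].
  - rewrite Rabs_pos_eq, Rpower_mult_distr by lra. apply Rle_Rpower_l; lra.
  - rewrite Rabs_left by exact Ha. set (b := - a).
    assert (Hpos : forall y, 0 < Rpower y b) by (intros y; apply exp_pos).
    replace a with (- b) by (unfold b; ring). rewrite !Rpower_Ropp.
    apply Rle_trans with (/ Rpower N b).
    + apply Rinv_le_contravar; [apply Hpos|]. apply Rle_Rpower_l; unfold b; lra.
    + rewrite <- Rmult_1_r at 1.
      apply Rmult_le_compat_l; [apply Rlt_le, Rinv_0_lt_compat, Hpos|].
      rewrite <- (Rpower_O P) by lra. apply Rle_Rpower; unfold b; lra.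
Qed.

Definition log_sublinear (P : nat -> R) : Prop :=
  forall eps, 0 < eps -> exists c, forall n, ln (P n) <= c + eps * INR n.

Lemma ln_le_scaled (eta x : R) : 0 < eta -> 0 < x -> ln x <= eta * x - ln eta.
Proof.
  intros He Hx. assert (Hp : 0 < eta * x) by now apply Rmult_lt_0_compat.
  pose proof (exp_ineq1_le (ln (eta * x))) as H.
  rewrite exp_ln, ln_mult in H by assumption. lra.
Qed.

Lemma log_sublinear_polynomial (a : R) (d : nat) :
  0 < a -> log_sublinear (fun n => a * (2 * INR n + 1) ^ d).
Proof.
  intros Ha eps He. pose proof (pos_INR d) as Hd.
  set (eta := eps / (2 * (INR d + 1))).
  assert (Heta : 0 < eta) by (apply Rdiv_lt_0_compat; lra).
  exists (ln a + INR d * (eta - ln eta)). intros n. pose proof (pos_INR n) as Hn.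
  assert (Hx : 0 < 2 * INR n + 1) by lra.
  rewrite ln_mult, ln_pow by auto using pow_lt.
  pose proof (Rmult_le_compat_l _ _ _ Hd (ln_le_scaled eta _ Heta Hx)) as Hln.
  assert (Hslope : 2 * INR d * eta * INR n <= eps * INR n).
  { apply Rmult_le_compat_r; [exact Hn|].
    replace eps with (2 * (INR d + 1) * eta) by (unfold eta; field; lra). lra. }
  lra.
Qed.

Lemma log_sublinear_blowup k : log_sublinear (fun n => INR (blowup k n)).
Proof.
  pose proof (pos_INR k).
  intros eps He. destruct (log_sublinear_polynomial (64 * (INR k + 1)) (2 * k)
    ltac:(lra) eps He) as [c Hc].
  exists c. intros n. unfold blowup.
  rewrite !mult_INR, pow_INR, !plus_INR, mult_INR, (INR_IZR_INZ 64). apply Hc.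
Qed.

Lemma big_O_le (f g h : nat -> R) c n0 :
  0 <= c -> (forall n, (n0 <= n)%nat -> f n <= c * g n) -> big_O g h -> big_O f h.
Proof.
  intros Hc Hf (C & n1 & Hg). exists (c * C), (max n0 n1). intros n Hn.
  rewrite Rmult_assoc. eapply Rle_trans; [apply Hf; lia|].
  apply Rmult_le_compat_l; [exact Hc|]. apply Hg. lia.
Qed.

Lemma half_power_big_O (P : nat -> R) gamma q delta :
  0 <= gamma -> 0 <= q -> gamma / 2 < delta -> log_sublinear P ->
  big_O (fun n => Rpower (INR (2 ^ half n)) gamma * Rpower (P n) q)
    (fun n => Rpower 2 (delta * INR n)).
Proof.
  intros Hg Hq Hd HP. assert (Hln2 : 0 < ln 2) by (rewrite <- ln_1; apply ln_increasing; lra).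
  set (slack := (delta - gamma / 2) * ln 2).
  assert (Hslack : 0 < slack) by (apply Rmult_lt_0_compat; lra).
  destruct (HP (slack / (q + 1))) as [c Hc]; [apply Rdiv_lt_0_compat; lra|].
  exists (exp (q * c + gamma / 2 * ln 2)), 0%nat. intros n _.
  unfold Rpower. rewrite <- !exp_plus. apply exp_le.
  rewrite pow_INR, ln_pow by (cbn; lra). change (INR 2) with 2.
  assert (Hhalf : gamma * (INR (half n) * ln 2) <= gamma / 2 * (INR n + 1) * ln 2).
  { rewrite <- !Rmult_assoc. apply Rmult_le_compat_r; [lra|].
    pose proof (le_INR _ _ (proj2 (half_spec n))) as Hle.
    rewrite mult_INR, plus_INR in Hle. change (INR 2) with 2 in Hle.
    change (INR 1) with 1 in Hle. pose proof (Rmult_le_compat_l _ _ _ Hg Hle). lra. }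
  assert (HlnP : q * ln (P n) <= q * c + slack * INR n).
  { pose proof (pos_INR n) as Hn.
    pose proof (Rmult_le_compat_l _ _ _ Hq (Hc n)) as Hqc.
    assert (Hshare : q * (slack / (q + 1)) <= slack).
    { replace slack with ((q + 1) * (slack / (q + 1))) at 2 by (field; lra).
      apply Rmult_le_compat_r; [apply Rlt_le, Rdiv_lt_0_compat; lra|lra]. }
    pose proof (Rmult_le_compat_r _ _ _ Hn Hshare). lra. }
  unfold slack in HlnP. lra.
Qed.

Lemma Rpower_mult_between (alpha beta gamma q N P x y : R) :
  1 <= N -> 1 <= P -> N <= x <= N * P -> N <= y <= N * P ->
  alpha + beta <= gamma -> Rabs alpha + Rabs beta <= q ->
  Rpower x alpha * Rpower y beta <= Rpower N gamma * Rpower P q.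
Proof.
  intros HN HP Hx Hy Hgamma Hq.
  assert (Hpos : forall z a, 0 <= Rpower z a) by (intros; apply Rlt_le, exp_pos).
  apply Rle_trans with ((Rpower N alpha * Rpower P (Rabs alpha)) *
                        (Rpower N beta * Rpower P (Rabs beta))).
  - apply Rmult_le_compat; auto; apply Rpower_between; lra.
  - replace (_ * _) with
      (Rpower N (alpha + beta) * Rpower P (Rabs alpha + Rabs beta))
      by (rewrite !Rpower_plus; ring).
    apply Rmult_le_compat; auto; now apply Rle_Rpower.
Qed.

Lemma INR_size_range k n x :
  In x (size_range k n) -> INR (2 ^ half n) <= INR x <= INR (2 ^ half n) * INR (blowup k n).
Proof.
  intros Hx. apply in_size_range in Hx as [H1 H2]. rewrite <- mult_INR. split; now apply le_INR.
Qed.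

Lemma sat_time_le g alpha beta gamma q C n0 k n :
  (forall m v, (n0 <= m)%nat -> (n0 <= v)%nat ->
     g m v <= C * (Rpower (INR m) alpha * Rpower (INR v) beta)) ->
  (n0 <= 2 ^ half n)%nat ->
  alpha + beta <= gamma -> 1 <= gamma -> Rabs alpha + Rabs beta <= q -> 1 <= q ->
  sat_time g k n <=
  (40 + Rabs C) * (Rpower (INR (2 ^ half n)) gamma * Rpower (INR (blowup k n)) q).
Proof.
  intros Hg Hn Hab Hgamma Habs Hq. unfold sat_time.
  assert (HN : 1 <= INR (2 ^ half n)) by apply (le_INR 1), pow2_pos.
  assert (HP : 1 <= INR (blowup k n)) by apply (le_INR 1), blowup_pos.
  rewrite Rmult_plus_distr_r. apply Rplus_le_compat.
  - apply Rmult_le_compat_l; [lra|]. rewrite mult_INR.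
    rewrite <- (Rpower_1 (INR (2 ^ half n))), <- (Rpower_1 (INR (blowup k n))) at 1 by lra.
    apply Rmult_le_compat; try (apply Rlt_le, exp_pos); now apply Rle_Rpower.
  - set (values := map _ _).
    assert (Hmax : In (MaxRlist values) values).
    { apply MaxRlist_P2. unfold values.
      assert (Hin : In (2 ^ half n)%nat (size_range k n))
        by (apply in_size_range; pose proof (blowup_pos k n); nia).
      eexists. apply in_map_iff. exists (2 ^ half n, 2 ^ half n)%nat.
      split; [reflexivity|now apply in_prod]. }
    apply in_map_iff in Hmax as ([m v] & <- & Hmv). apply in_prod_iff in Hmv as [Hm Hv].
    eapply Rle_trans; [apply Hg; [apply in_size_range in Hm|apply in_size_range in Hv]; lia|].
    eapply Rle_trans.
    + apply Rmult_le_compat_r; [|apply Rle_abs].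
      apply Rmult_le_pos; apply Rlt_le, exp_pos.
    + apply Rmult_le_compat_l; [apply Rabs_pos|].
      apply Rpower_mult_between; auto using INR_size_range.
Qed.

Lemma sat_time_big_O g alpha beta C n0 k delta :
  (forall m n, (n0 <= m)%nat -> (n0 <= n)%nat ->
     g m n <= C * (Rpower (INR m) alpha * Rpower (INR n) beta)) ->
  Rmax (alpha + beta) 1 / 2 < delta ->
  big_O (sat_time g k) (fun n => Rpower 2 (delta * INR n)).
Proof.
  intros Hg Hdelta. set (gamma := Rmax (alpha + beta) 1) in *.
  assert (Hgamma : alpha + beta <= gamma /\ 1 <= gamma) by (split; [apply Rmax_l|apply Rmax_r]).
  pose proof (Rabs_pos alpha). pose proof (Rabs_pos beta). pose proof (Rabs_pos C).
  eapply big_O_le with (c := 40 + Rabs C) (n0 := (2 * n0)%nat); [lra| |].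
  - intros n Hn. pose proof (half_spec n). pose proof (Nat.pow_gt_lin_r 2 (half n)).
    apply (sat_time_le g alpha beta gamma (Rabs alpha + Rabs beta + 1) C n0);
      [exact Hg|lia|lra..].
  - apply half_power_big_O; [lra|lra|exact Hdelta|apply log_sublinear_blowup].
Qed.

Theorem theorem5 :
  SETH ->
  forall directed weighted : bool,
    ~ exists g : nat -> nat -> R,
        sub_mn g /\ Eccentricities_in_time directed weighted g.
Proof.
  intros Hseth directed weighted (g & (alpha & beta & Hab & C & n0 & Hg) & Hecc).
  set (gamma := Rmax (alpha + beta) 1).
  assert (Hgamma : gamma < 2) by (apply Rmax_lub_lt; lra).
  destruct (Hseth (1 / 2 + gamma / 4)) as [k Hk]; [lra|]. apply Hk.
  exists (sat_time g k). split.
  - apply (sat_time_big_O g alpha beta C n0); [exact Hg|]. fold gamma. lra.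
  - now apply kSAT_of_eccentricities with directed weighted.
Qed.
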